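(* Let $\epsilon>0$ be arbitrary and let $$f_s(x):=\begin{cases}-\frac{\sqrt3}{\pi}\log\left(1-e^{\frac{\pi}{\sqrt3}x}\right) & \text{if } x<0,\\[2pt] -\frac{\sqrt3}{\pi}\log\left(1-e^{-\frac{\pi}{\sqrt3}x}\right) & \text{if } x>0.\end{cases}$$ Then $$\lim_{n\to\infty}\frac{1}{s(n)}\cdot\#\left\{\lambda\in\mathscr{S}(n):\widetilde{\varphi}(\lambda)\subset N_\epsilon(f_s)\right\}=1,$$ where $\mathscr{S}(n)$ is the set of all (unrestricted) unimodal sequences of size $n$ and $s(n)=\#\mathscr{S}(n)$.
   Context: A unimodal sequence of size $n$ is a finite sequence $\lambda=(\lambda_1,\dots,\lambda_s)$ of positive integers with $\sum_{j=1}^s\lambda_j=n$ such that for some $k$, $0<\lambda_1\le\dots\le\lambda_{k-1}\le\lambda_k\ge\lambda_{k+1}\ge\dots\ge\lambda_s>0$. Its peaks are $\lambda_k$ and any other parts equal to $\lambda_k$ (i.e. the parts of maximal size). Sequences are counted as sequences (not with a designated $k$); e.g. $s(4)=8$. The diagram of $\lambda$ is the set of adjacent columns of unit squares in the plane standing on the $x$-axis, the $j$-th column having $\lambda_j$ squares, placed horizontally so that the left edge of the left-most peak column lies on the $y$-axis; that is, if $k$ is the smallest index with $\lambda_k$ maximal, the $j$-th column is $[j-k,j-k+1]\times[0,\lambda_j]$. The shape $\varphi(\lambda)$ is the upper border of the diagram: the polygonal path, consisting of horizontal and vertical segments, that starts at the left-most bottom corner of the diagram on the $x$-axis, follows the tops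 of the columns (with the vertical segments joining consecutive tops), and ends at the right-most bottom corner on the $x$-axis. The renormalized shape $\widetilde{\varphi}(\lambda)$ is obtained from $\varphi(\lambda)$ by rescaling both axes by $1/\sqrt n$, where $n$ is the size of $\lambda$. For a real function $f$ defined on a subset of $\mathbb{R}$, $N_\epsilon(f)$ is the set of points in the plane whose horizontal distance from the curve $y=f(x)$ is at most $\epsilon$ (i.e. points $(x_0,y_0)$ for which there is $x$ in the domain of $f$ with $f(x)=y_0$ and $|x-x_0|\le\epsilon$), together with the $\epsilon$-neighborhoods of the $x$-axis and of the $y$-axis (points at distance at most $\epsilon$ from one of the axes). *)

(* Defs.v *)
From mathcomp Require Import all_boot all_order all_algebra.
From mathcomp Require Import finmap.
From mathcomp Require Import all_classical all_reals all_analysis.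

Set Implicit Arguments.
Unset Strict Implicit.
Unset Printing Implicit Defensive.

Import Order.TTheory GRing.Theory Num.Theory.
Local Open Scope classical_set_scope.
Local Open Scope ring_scope.

Definition unimodal (l : seq nat) : Prop :=
  all (ltn 0%N) l /\
  exists k : nat, [/\ (k < size l)%N, sorted leq (take k.+1 l)
                    & sorted geq (drop k l)].

Definition unimodal_seqs (n : nat) : set (seq nat) :=
  [set l | unimodal l /\ sumn l = n].

Lemma finite_unimodal_seqs (n : nat) : finite_set (unimodal_seqs n).
Proof.
apply: (@sub_finite_set _ _
  [set map val (t : seq 'I_n.+1) | t in [set: n.-bseq 'I_n.+1]]); last first.
  exact/finite_image/finite_finset.
move=> l [[/allP lpos _] suml].
have size_le : (size (map (@inord n) l) <= n)%N.
  rewrite size_map -suml; elim: l lpos {suml} => //= a l IH lpos.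
  rewrite -add1n leq_add ?lpos ?mem_head // IH // => x xl.
  by rewrite lpos // inE xl orbT.
exists (Bseq size_le) => //=; rewrite -map_comp -[RHS]map_id.
apply/eq_in_map => x xl /=; rewrite inordK // ltnS -suml.
elim: l xl {lpos suml size_le} => //= a l IH; rewrite inE => /predU1P[->|/IH].
  exact: leq_addr.
by move=> /leq_trans; apply; exact: leq_addl.
Qed.

(* Indices are 0-based, here and below. *)
Definition left_peak (l : seq nat) : nat := index (\max_(a <- l) a)%N l.

(* Column [j] of the diagram is [bd l j, bd l j.+1] x [0, l_j]. *)
Definition bd (R : realType) (l : seq nat) (j : nat) : R :=
  j%:R - (left_peak l)%:R.

(* The tops of the columns, then the vertical segments at the abscissas
   [bd l j] for [0 <= j <= size l]: such a segment joins the heights of the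
   columns [j - 1] and [j], a missing column (to the left of the first one or
   to the right of the last one) having height 0. *)
Definition useq_shape (R : realType) (l : seq nat) : set (R * R) :=
  [set p : R * R | exists2 j : nat, (j < size l)%N &
     bd R l j <= p.1 <= bd R l j.+1 /\ p.2 = (nth 0 l j)%N%:R] `|`
  [set p : R * R | exists2 j : nat, (j <= size l)%N &
     p.1 = bd R l j /\
     (minn (nth 0 (0 :: l) j) (nth 0 l j))%N%:R <= p.2
       <= (maxn (nth 0 (0 :: l) j) (nth 0 l j))%N%:R].

Arguments useq_shape : clear implicits.

Definition renormalized_shape (R : realType) (l : seq nat) : set (R * R) :=
  [set (p.1 / Num.sqrt (sumn l)%:R, p.2 / Num.sqrt (sumn l)%:R)
     | p in useq_shape R l].

Arguments renormalized_shape : clear implicits.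

(* [f] is only considered on its domain [D]; the distances from [p] to the
   x-axis and to the y-axis are [`|p.2|] and [`|p.1|]. *)
Definition curve_nbhd (R : realType) (eps : R) (D : set R) (f : R -> R) :
    set (R * R) :=
  [set p : R * R | (exists x : R, [/\ D x, f x = p.2 & `|x - p.1| <= eps])
           \/ `|p.2| <= eps \/ `|p.1| <= eps].

Definition f_s_dom (R : realType) : set R := [set x | x != 0].

(* Meaningful on [f_s_dom] only. *)
Definition f_s (R : realType) (x : R) : R :=
  if x < 0 then - (Num.sqrt 3 / pi) * ln (1 - expR (pi / Num.sqrt 3 * x))
  else - (Num.sqrt 3 / pi) * ln (1 - expR (- (pi / Num.sqrt 3) * x)).

Arguments f_s_dom : clear implicits.
Arguments f_s : clear implicits.

(* Main.v *)
Require Import Defs.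
From mathcomp Require Import all_boot all_order all_algebra.
From mathcomp Require Import finmap.
From mathcomp Require Import all_classical all_reals all_analysis.
From mathcomp Require Import ring lra zify.
Import Order.TTheory GRing.Theory Num.Theory.
Import numFieldNormedType.Exports.
Local Open Scope classical_set_scope.
Local Open Scope ring_scope.

Set Implicit Arguments.
Unset Strict Implicit.
Unset Printing Implicit Defensive.

(** Cutting a unimodal sequence before its left-most peak gives two partitions,
    and the border of its diagram at height [y] lies at the number of parts
    larger than [y], on one side or the other. Under the Boltzmann law of
    parameter [t], where the multiplicities of the parts [j] are independent
    and geometric of ratio [expR (- t * j)], the mean number of parts larger
    than [m] on one side is close to [Gfun (t * m) / t], where
    [Gfun z = - ln (1 - expR (- z))], and deviations of order [1 / t] are
    exponentially unlikely in [1 / t] (lemmas [nlarge_ub], [nlarge_lb] and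
    [tail_deviation_prob]). For [t = c / Num.sqrt n] with [c = pi / sqrt 3] this
    is the claimed shape (lemma [tail_counts_shape]).

    It remains to pass from the Boltzmann law to sequences of size exactly [n].
    The mean size is asymptotic to [2 * zeta 2 / t ^ 2 = (c / t) ^ 2], by the
    evaluation of [zeta 2] (lemmas [inv_sqr_sum_le] and [inv_sqr_sum_near],
    through exact sums of [1 / sin x ^ 2]), and the size is concentrated. With
    [t = a / Num.sqrt n] and [a] slightly larger than [c], the size is
    typically [(1 - w) * n] with [w] small; one large peak completes such a pair
    of partitions to a unimodal sequence of size [n] (lemmas
    [decode_unimodal] and [decode_inj]). Hence
    the number of these sequences is at least
    [expR ((1 - 3 / 2 * w) * t * n) / (2 * Z)], where [Z] is the normalising
    constant, whereas the number of those with a deviating tail count is at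
    most [expR (t * n) / Z] times an exponentially small probability. In the
    quotient [Z] disappears, and as [w * t * n] is a small multiple of
    [Num.sqrt n], the exponentially small factor wins. *)

(** * Truncated geometric laws and the exponential Chebyshev bound *)

(** The weights are normalised as for multiplicities without the bound [K], so
    that their sum is slightly less than [1] but the bounds below do not
    involve [K]. *)
Definition gweight (R : realType) (I : finType) (K : nat) (x : I -> R)
    (L : {ffun I -> 'I_K.+1}) : R :=
  \prod_i ((1 - x i) * x i ^+ L i).

Lemma gweight_ge0 (R : realType) (I : finType) (K : nat) (x : I -> R)
    (L : {ffun I -> 'I_K.+1}) :
  (forall i, 0 < x i < 1) -> 0 <= gweight x L.
Proof.
move=> x01; apply: prodr_ge0 => i _; case/andP: (x01 i) => x0 x1.
by rewrite mulr_ge0 ?exprn_ge0 ?subr_ge0// ltW.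
Qed.

Lemma sum_prod_ffun (R : realType) (I : finType) (K : nat) (y : I -> R) :
  \sum_(L : {ffun I -> 'I_K.+1}) \prod_i y i ^+ L i
  = \prod_i \sum_(k < K.+1) y i ^+ k.
Proof. by rewrite bigA_distr_bigA. Qed.

Lemma geometric_sum (R : realType) (K : nat) (z : R) :
  (1 - z) * (\sum_(k < K.+1) z ^+ k) = 1 - z ^+ K.+1.
Proof. by rewrite -[RHS]opprB subrX1 -mulNr opprB. Qed.

Lemma sum_gweight (R : realType) (I : finType) (K : nat) (x : I -> R) :
  \sum_(L : {ffun I -> 'I_K.+1}) gweight x L = \prod_i (1 - x i ^+ K.+1).
Proof.
transitivity (\sum_(L : {ffun I -> 'I_K.+1})
    (\prod_i (1 - x i)) * \prod_i x i ^+ L i).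
  by apply: eq_bigr => L _; rewrite /gweight big_split.
rewrite -big_distrr /= sum_prod_ffun -big_split /=.
by apply: eq_bigr => i _; rewrite geometric_sum.
Qed.

Lemma prod_onem_ge (R : realType) (I : finType) (z : I -> R) :
  (forall i, 0 <= z i <= 1) -> 1 - \sum_i z i <= \prod_i (1 - z i).
Proof.
move=> z01; suff: 1 - \sum_i z i <= \prod_i (1 - z i) /\
    0 <= \prod_i (1 - z i) <= 1 by case.
apply: (big_ind2 (fun s p => 1 - s <= p /\ 0 <= p <= 1)).
- by rewrite subr0 lexx ler01.
- by move=> s p t q [h1 /andP[h2 h3]] [k1 /andP[k2 k3]]; split; [|apply/andP; split]; nra.
- by move=> i _; rewrite lexx; split=> //; have := z01 i; lra.
Qed.

Lemma sum_gweight_ge (R : realType) (I : finType) (K : nat) (x : I -> R) :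
  (forall i, 0 < x i < 1) ->
  1 - \sum_i x i ^+ K.+1 <= \sum_(L : {ffun I -> 'I_K.+1}) gweight x L.
Proof.
move=> x01; rewrite sum_gweight; apply: prod_onem_ge => i.
by case/andP: (x01 i) => x0 x1; rewrite exprn_ge0 ?exprn_ile1 ?ltW.
Qed.

(** Replacing the ratios [x] by [y] tilts the law; the new normalising factor
    [\prod_i (1 - x i) / (1 - y i)] is at most the exponential of the sum of
    its first-order terms, since [1 + u <= expR u]. *)
Lemma chernoff (R : realType) (I : finType) (K : nat) (x y : I -> R) (C : R)
    (A : {set {ffun I -> 'I_K.+1}}) :
  (forall i, 0 < x i < 1) -> (forall i, 0 < y i < 1) -> 0 <= C ->
  (forall L, L \in A ->
     \prod_i x i ^+ (L i : nat) <= C * \prod_i y i ^+ (L i : nat)) ->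
  \sum_(L in A) gweight x L <= C * expR (\sum_i (y i - x i) / (1 - y i)).
Proof.
move=> x01 y01 C0 hA.
have px0 : 0 <= \prod_i (1 - x i).
  by apply: prodr_ge0 => i _; have := x01 i; lra.
apply: (@le_trans _ _
    (\sum_(L : {ffun I -> 'I_K.+1}) \prod_i (1 - x i) *
      (C * \prod_i y i ^+ (L i : nat)))).
  rewrite [leRHS](bigID (mem A))/= -[leLHS]addr0; apply: lerD.
    apply: ler_sum => L LA; rewrite /gweight big_split/=.
    by rewrite ler_wpM2l// hA.
  apply: sumr_ge0 => L _; rewrite mulr_ge0// mulr_ge0// prodr_ge0// => i _.
  by rewrite exprn_ge0//; have := y01 i; lra.
rewrite -big_distrr/= -big_distrr/= sum_prod_ffun mulrCA ler_wpM2l//.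
rewrite -big_split/= expR_sum; apply: ler_prod => i _.
have /andP[x0 x1] := x01 i; have /andP[y0 y1] := y01 i.
have s0 : 0 <= \sum_(k < K.+1) y i ^+ k.
  by apply: sumr_ge0 => k _; rewrite exprn_ge0 ?ltW.
rewrite mulr_ge0 ?subr_ge0 ?(ltW x1)//=.
apply: le_trans (expR_ge1Dx _).
have y1' : 0 < 1 - y i by rewrite subr_gt0.
have -> : 1 + (y i - x i) / (1 - y i) = (1 - x i) / (1 - y i).
  by field; rewrite gt_eqF.
rewrite ler_wpM2l ?subr_ge0 ?(ltW x1)// -div1r ler_pdivlMr// mulrC.
by rewrite geometric_sum gerBl exprn_ge0// ltW.
Qed.

(** * The function whose graph is the limit shape *)

(** [Gfun (t * m) / t] is, to first order in [t], the expected number of parts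
    above [m] on one side; up to scale its graph is a branch of the limit
    shape. *)
Definition Gfun (R : realType) (z : R) : R := - ln (1 - expR (- z)).

Lemma onem_expRN_gt0 (R : realType) (z : R) : 0 < z -> 0 < 1 - expR (- z).
Proof. by move=> z0; rewrite subr_gt0 expR_lt1 oppr_lt0. Qed.

Lemma expR_subr1_gt0 (R : realType) (z : R) : 0 < z -> 0 < expR z - 1.
Proof. by move=> z0; rewrite subr_gt0 expR_gt1. Qed.

Lemma ln_le_subr1 (R : realType) (x : R) : 0 < x -> ln x <= x - 1.
Proof.
move=> x0; have -> : ln x = ln (1 + (x - 1)) by congr ln; ring.
by apply: le_ln1Dx; lra.
Qed.

(** [Gfun] is convex with derivative [- 1 / (expR z - 1)], up to sign the
    mean number of parts of a given size: this is what makes the tail counts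
    telescope. *)
Lemma Gfun_diff (R : realType) (u v : R) : 0 < u -> u <= v ->
  (v - u) / (expR v - 1) <= Gfun u - Gfun v <= (v - u) / (expR u - 1).
Proof.
move=> u0 uv; have v0 : 0 < v by exact: lt_le_trans uv.
have U := onem_expRN_gt0 u0; have V := onem_expRN_gt0 v0.
have eu := expR_subr1_gt0 u0; have ev := expR_subr1_gt0 v0.
have U' := expR_gt0 u; have V' := expR_gt0 v.
have key (a b : R) : 0 < a -> 0 < b -> Gfun b - Gfun a <=
    (expR (- b) - expR (- a)) / (1 - expR (- b)).
  move=> a0 b0; have A := onem_expRN_gt0 a0; have B := onem_expRN_gt0 b0.
  rewrite /Gfun opprK addrC -ln_div ?posrE//.
  apply: le_trans (ln_le_subr1 _) _; first exact: divr_gt0.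
  by rewrite le_eqVlt; apply/orP; left; apply/eqP; field; rewrite gt_eqF.
apply/andP; split.
- rewrite -lerN2 opprB; apply: le_trans (key _ _ u0 v0) _.
  have -> : (expR (- v) - expR (- u)) / (1 - expR (- v)) =
      - ((expR (v - u) - 1) / (expR v - 1)).
    rewrite expRD !expRN; field.
    by rewrite (gt_eqF U') (gt_eqF V') gt_eqF.
  rewrite lerN2 ler_pM2r ?invr_gt0//.
  by have := expR_ge1Dx (v - u); lra.
- apply: le_trans (key _ _ v0 u0) _.
  have -> : (expR (- u) - expR (- v)) / (1 - expR (- u)) =
      (1 - expR (- (v - u))) / (expR u - 1).
    rewrite opprB expRD !expRN; field.
    by rewrite (gt_eqF U') (gt_eqF V') gt_eqF.
  rewrite ler_pM2r ?invr_gt0//.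
  by have := expR_ge1Dx (- (v - u)); lra.
Qed.

Lemma Gfun_diff_le (R : realType) (u v : R) : 0 < u -> u <= v ->
  Gfun u - Gfun v <= (v - u) / u.
Proof.
move=> u0 uv; have /andP[_ /le_trans->//] := Gfun_diff u0 uv.
apply: ler_wpM2l; first by rewrite subr_ge0.
by rewrite lef_pV2 ?posrE ?expR_subr1_gt0//; have := expR_ge1Dx u; lra.
Qed.

Lemma Gfun_anti (R : realType) (u v : R) : 0 < u -> u <= v ->
  Gfun v <= Gfun u.
Proof.
move=> u0 uv; have /andP[h _] := Gfun_diff u0 uv.
rewrite -subr_ge0; apply: le_trans h.
rewrite divr_ge0 ?subr_ge0// ltW// expR_gt1; exact: lt_le_trans uv.
Qed.

Lemma Gfun_gt0 (R : realType) (z : R) : 0 < z -> 0 < Gfun z.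
Proof.
move=> z0; rewrite oppr_gt0 ln_lt0// onem_expRN_gt0//=.
by have := expR_gt0 (- z); lra.
Qed.

(** The curve [y = Gfun x] is [expR (- x) + expR (- y) = 1], symmetric in the
    two coordinates. *)
Lemma GfunK (R : realType) (z : R) : 0 < z -> Gfun (Gfun z) = z.
Proof.
move=> z0; rewrite {1}/Gfun opprK lnK ?posrE ?onem_expRN_gt0//.
by rewrite opprB addrC subrK expRK opprK.
Qed.

Lemma Gfun_le (R : realType) (z : R) : 0 < z -> Gfun z <= (expR z - 1)^-1.
Proof.
move=> z0; have Z := onem_expRN_gt0 z0; have z1 := expR_subr1_gt0 z0.
rewrite /Gfun -lnV ?posrE//; apply: le_trans (ln_le_subr1 _) _.
  by rewrite invr_gt0.
rewrite le_eqVlt; apply/orP; left; apply/eqP; rewrite expRN; field.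
by rewrite (gt_eqF (expR_gt0 z)) gt_eqF.
Qed.

Lemma Gfun_le2 (R : realType) (z : R) : 0 < z -> Gfun z <= 2 / z ^+ 2.
Proof.
move=> z0; apply: le_trans (Gfun_le z0) _.
have z2 : 0 < z ^+ 2 by rewrite exprn_gt0.
rewrite -[leRHS]invf_div lef_pV2 ?posrE ?divr_gt0 ?expR_subr1_gt0//.
by have := expR_ge1Dxn 1 (ltW z0); rewrite [(2`!)%:R]/=; lra.
Qed.

(** * Number of large parts under the Boltzmann law *)

(** The multiplicity of the part [i.+1] on the side [b] of the peak is the value
    at [(b, i)], with [b = false] on the left. Having both sides in one function
    makes every event below, about one side or about the total size, an
    instance of a single exponential inequality. *)
Notation mults n K := {ffun bool * 'I_n -> 'I_K.+1}.

(** With these ratios a pair of partitions of total size [m] has probability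
    proportional to [expR (- t * m)]. *)
Definition boltzmann (R : realType) (t : R) (n : nat) (p : bool * 'I_n) : R :=
  expR (- (t * p.2.+1%:R)).

Definition nlarge (n K : nat) (L : mults n K) (b : bool) (m : nat) : nat :=
  \sum_(i < n | (m <= i)%N) L (b, i).

Lemma boltzmann01 (R : realType) (t : R) (n : nat) (p : bool * 'I_n) :
  0 < t -> 0 < boltzmann t p < 1.
Proof.
by move=> t0; rewrite expR_gt0 expR_lt1 oppr_lt0 mulr_gt0// ltr0n.
Qed.

(** Tilting only the parts above [m] on the side [b]. Both tails are covered:
    [th > 0] for an excess of large parts, [th < 0] for a deficit. *)
Lemma nlarge_tilt (R : realType) (t th a : R) (n K m : nat) (b : bool)
    (A : {set mults n K}) :
  0 < t -> th < t * m.+1%:R ->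
  (forall L, L \in A -> th * a <= th * (nlarge L b m)%:R) ->
  \sum_(L in A) gweight (@boltzmann R t n) L <=
  expR ((1 - expR (- th)) *
          (\sum_(m <= i < n) (expR (t * i.+1%:R - th) - 1)^-1) - th * a).
Proof.
move=> t0 tht hA.
pose y (p : bool * 'I_n) : R :=
  if (p.1 == b) && (m <= p.2)%N then expR th * boltzmann t p else boltzmann t p.
have ty (i : nat) : (m <= i)%N -> th < t * i.+1%:R.
  by move=> mi; apply: lt_le_trans tht _; rewrite ler_wpM2l ?(ltW t0)// ler_nat ltnS.
have y01 p : 0 < y p < 1.
  rewrite /y; case: ifPn => [/andP[_ mp]|_]; last exact: boltzmann01.
  by rewrite /boltzmann -expRD expR_gt0 expR_lt1 subr_lt0 ty.
apply: le_trans (@chernoff R _ K (@boltzmann R t n) y (expR (- (th * a))) A _ y01 (expR_ge0 _) _) _.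
- by move=> p; exact: boltzmann01.
- move=> L LA.
  have -> : \prod_p y p ^+ (L p : nat) =
      expR (th * (nlarge L b m)%:R) * \prod_p boltzmann t p ^+ (L p : nat).
    transitivity (\prod_(p : bool * 'I_n) ((if (p.1 == b) && (m <= p.2)%N
        then expR th ^+ (L p : nat) else 1) * boltzmann t p ^+ (L p : nat))).
      apply: eq_bigr => p _; rewrite /y; case: ifP => _; last by rewrite mul1r.
      by rewrite exprMn.
    rewrite big_split/=; congr (_ * _); rewrite -big_mkcond/=.
    rewrite /nlarge natr_sum mulr_sumr expR_sum.
    under [RHS]eq_bigr do rewrite expRM_natr.
    pose F b' (i : 'I_n) := expR th ^+ (L (b', i) : nat).
    rewrite (eq_bigr (fun p : bool * 'I_n => F p.1 p.2)); last by case.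
    rewrite -(pair_big (fun b' => b' == b) (fun i : 'I_n => (m <= i)%N) F)/=.
    by rewrite big_pred1_eq.
  rewrite mulrA -expRD ler_peMl//; last first.
    by apply: le_trans (expR_ge1Dx _); have := hA L LA; lra.
  by apply: prodr_ge0 => p _; rewrite exprn_ge0// expR_ge0.
- rewrite -expRD ler_expR addrC lerD2r.
  pose F (b' : bool) (i : 'I_n) : R := if (b' == b) && (m <= i)%N
    then (1 - expR (- th)) * (expR (t * i.+1%:R - th) - 1)^-1 else 0.
  rewrite (eq_bigr (fun p : bool * 'I_n => F p.1 p.2)); last first.
    move=> [b' i] _; rewrite /F /y/=.
    case: ifPn => [bm|_]; last by rewrite subrr mul0r.
    have /andP[_ mi] := bm.
    have ti := ty i mi; rewrite /boltzmann/=.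
    have h1 : 0 < expR (t * i.+1%:R - th) - 1 by rewrite expR_subr1_gt0// subr_gt0.
    move: h1; rewrite expRD !expRN.
    set u := expR th; set v := expR _; move=> h1.
    have u0 : 0 < u := expR_gt0 _; have v0 : 0 < v := expR_gt0 _.
    have h2 : 0 < v - u.
      by rewrite -(pmulr_lgt0 _ (_ : 0 < u^-1)) ?invr_gt0// mulrBl mulfV ?gt_eqF.
    by field; rewrite mulN1r !gt_eqF.
  rewrite -(pair_bigA _ F)/= (bigD1 b)//= [X in _ + X]big1 ?addr0; last first.
    by move=> b' /negbTE bb; rewrite big1// => i _; rewrite /F bb.
  rewrite mulr_sumr /F eqxx/= -big_mkcond/=.
  rewrite -(big_mkord (fun i => (m <= i)%N)
    (fun i => (1 - expR (- th)) * (expR (t * i.+1%:R - th) - 1)^-1)).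
  by rewrite (big_nat_widenl m 0)//=.
Qed.

(** Under the tilted law the expected number of parts above [m] is at most
    [Gfun (t * m - th) / t]: each term is bounded by an increment of [Gfun],
    and the increments telescope. *)
Lemma nlarge_ub (R : realType) (t th a : R) (n K m : nat) (b : bool) :
  0 < t -> 0 < th -> th < t * m%:R ->
  \sum_(L : mults n K | a <= t * (nlarge L b m)%:R)
    gweight (@boltzmann R t n) L <=
  expR (th / t * (Gfun (t * m%:R - th) - a)).
Proof.
move=> t0 th0 thm.
have tht i : (m <= i)%N -> th < t * i%:R.
  by move=> mi; apply: lt_le_trans thm _; rewrite ler_wpM2l ?(ltW t0)// ler_nat.
rewrite (eq_bigl (fun L => L \in [set L : mults n K | a <= t * (nlarge L b m)%:R]%SET)); last first.
  by move=> L; rewrite inE.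
apply: le_trans (@nlarge_tilt R t th (a / t) n K m b _ t0 (tht _ (leqnSn m)) _) _.
  by move=> L; rewrite inE => aL; rewrite ler_pM2l// ler_pdivrMr// mulrC.
set s := \sum_(_ <= _ < _) _.
have s0 : 0 <= s.
  rewrite /s big_nat_cond; apply: sumr_ge0 => i; rewrite andbT => /andP[mi _].
  by rewrite invr_ge0 ltW// expR_subr1_gt0// subr_gt0 tht// ltnW.
have ts : t * s <= Gfun (t * m%:R - th).
  have [mn|nm] := leqP m n; last first.
    by rewrite /s big_geq 1?ltnW// mulr0 ltW// Gfun_gt0// subr_gt0.
  apply: (@le_trans _ _ (Gfun (t * m%:R - th) - Gfun (t * n%:R - th))); last first.
    by rewrite gerBl ltW// Gfun_gt0// subr_gt0 tht.
  rewrite -[leRHS]opprB -(telescope_sumr (fun i => Gfun (t * i%:R - th)))//.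
  rewrite -sumrN mulr_sumr; apply: ler_sum_nat => i /andP[mi _].
  rewrite opprB.
  have u0 : 0 < t * i%:R - th by rewrite subr_gt0 tht.
  have uv : t * i%:R - th <= t * i.+1%:R - th.
    by rewrite lerD2r ler_wpM2l ?(ltW t0)// ler_nat.
  have /andP[h _] := Gfun_diff u0 uv.
  apply: le_trans h; rewrite le_eqVlt; apply/orP; left; apply/eqP.
  by congr (_ / _); rewrite -natr1; ring.
rewrite ler_expR.
apply: (@le_trans _ _ (th * s - th * (a / t))).
  by rewrite lerD2r ler_wpM2r//; have := expR_ge1Dx (- th); lra.
have -> : th * s - th * (a / t) = th / t * (t * s - a) by field; rewrite gt_eqF.
by rewrite ler_wpM2l ?lerD2r// divr_ge0 ?ltW.
Qed.

(** The same telescoping from below; the part sizes stop at [n], whence the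
    correction [Gfun (t * n.+1 + th)]. *)
Lemma nlarge_lb (R : realType) (t th a : R) (n K m : nat) (b : bool) :
  0 < t -> 0 < th -> (m <= n)%N ->
  \sum_(L : mults n K | t * (nlarge L b m)%:R <= a)
    gweight (@boltzmann R t n) L <=
  expR (th / t *
    (a - Gfun (t * m.+1%:R + th) + Gfun (t * n.+1%:R + th))).
Proof.
move=> t0 th0 mn.
have pos i : 0 < t * i.+1%:R + th by rewrite addr_gt0// mulr_gt0// ltr0n.
rewrite (eq_bigl (fun L => L \in [set L : mults n K | t * (nlarge L b m)%:R <= a]%SET)); last first.
  by move=> L; rewrite inE.
apply: le_trans (@nlarge_tilt R t (- th) (a / t) n K m b _ t0 _ _) _.
- by apply: (@lt_trans _ _ 0); rewrite ?oppr_lt0// mulr_gt0// ltr0n.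
- by move=> L; rewrite inE => aL; rewrite !mulNr lerN2 ler_pM2l// ler_pdivlMr// mulrC.
set s := \sum_(_ <= _ < _) _.
have s0 : 0 <= s.
  rewrite /s; apply: sumr_ge0 => i _; rewrite opprK.
  by rewrite invr_ge0 ltW// expR_subr1_gt0.
have ts : Gfun (t * m.+1%:R + th) - Gfun (t * n.+1%:R + th) <= t * s.
  rewrite -[leLHS]opprB -(telescope_sumr (fun i => Gfun (t * i.+1%:R + th)))//.
  rewrite -sumrN mulr_sumr; apply: ler_sum_nat => i _.
  have e : t * i.+1%:R - - th = t * i.+1%:R + th by rewrite opprK.
  rewrite opprB e.
  have uv : t * i.+1%:R + th <= t * i.+2%:R + th.
    by rewrite lerD2r ler_wpM2l ?(ltW t0)// ler_nat.
  have /andP[_ h] := Gfun_diff (pos i) uv.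
  apply: le_trans h _; rewrite le_eqVlt; apply/orP; left; apply/eqP.
  by congr (_ / _); rewrite -natr1; ring.
rewrite ler_expR opprK.
apply: (@le_trans _ _ (- th * s - - th * (a / t))).
  by rewrite lerD2r ler_wpM2r//; have := expR_ge1Dx th; lra.
have -> : - th * s - - th * (a / t) = th / t * (a - t * s) by field; rewrite gt_eqF.
by rewrite ler_wpM2l ?divr_ge0 ?(ltW th0) ?(ltW t0)//; lra.
Qed.

(** * The sum of the inverse squares *)

Lemma sin_le (R : realType) (x : R) : 0 <= x -> sin x <= x.
Proof.
move=> x0; have [|c _] := @MVT_segment R sin cos 0 x x0 (fun c _ => is_derive_sin c).
  exact/continuous_subspaceT/continuous_sin.
by rewrite sin0 !subr0 => ->; rewrite ler_piMl// cos_le1.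
Qed.

Lemma le_tan (R : realType) (x : R) : 0 <= x < pi / 2 -> x <= tan x.
Proof.
move=> /andP[x0 xpi].
have cpos (c : R) : 0 <= c <= x -> 0 < cos c.
  by move=> /andP[c0 cx]; apply: cos_gt0_pihalf; have := pi_gt0 R; lra.
have [c|c|c] := @MVT_segment R tan (fun c => (cos c) ^- 2) 0 x x0.
- rewrite in_itv/= => /andP[c0 cx]; apply: is_derive_tan.
  by rewrite gt_eqF// cpos// !ltW.
- by move: c; apply: derivable_within_continuous => c; rewrite in_itv/= => /cpos c0;
     apply: derivable_tan; rewrite gt_eqF.
- rewrite in_itv/= tan0 !subr0 => /cpos c0 ->.
  by rewrite ler_peMl// invf_ge1 ?exprn_gt0// exprn_ile1 ?cos_le1// ltW.
Qed.

Lemma sin_gt0_le_pihalf (R : realType) (x : R) : 0 < x <= pi / 2 -> 0 < sin x.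
Proof. by move=> /andP[x0 x1]; apply: sin_gt0_pi; have := pi_gt0 R; lra. Qed.

Lemma inv_sin2_bounds (R : realType) (x : R) : 0 < x < pi / 2 ->
  (sin x) ^- 2 - 1 <= x ^- 2 <= (sin x) ^- 2.
Proof.
move=> /andP[x0 x1]; have s0 : 0 < sin x by rewrite sin_gt0_le_pihalf// x0 ltW.
have c0 : 0 < cos x by apply: cos_gt0_pihalf; have := pi_gt0 R; lra.
apply/andP; split; last first.
  by rewrite lef_pV2 ?posrE ?exprn_gt0// lerXn2r ?nnegrE ?sin_le ?(ltW s0) ?(ltW x0).
have t0 : 0 < tan x by rewrite divr_gt0.
have -> : (sin x) ^- 2 - 1 = (tan x) ^- 2.
  transitivity (cos x ^+ 2 / sin x ^+ 2); first by rewrite cos2sin2; field; rewrite gt_eqF.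
  by rewrite /tan; field; rewrite !gt_eqF.
by rewrite lef_pV2 ?posrE ?exprn_gt0// lerXn2r ?nnegrE ?le_tan ?(ltW t0) ?(ltW x0).
Qed.

(** The identity [1 / sin x ^ 2 = (1 / sin (x/2) ^ 2 + 1 / cos (x/2) ^ 2) / 4]
    doubles the number of nodes. *)
Lemma sum_inv_sin2 (R : realType) (m : nat) :
  \sum_(k < 2 ^ m) (sin (k.*2.+1%:R * (pi / (4 * 2 ^+ m)) : R)) ^- 2 =
  2 * 4 ^+ m.
Proof.
elim: m => [|m IHm].
  rewrite expn0 big_ord1 !expr0 !mulr1 mul1r.
  have e : sin (pi / 4 : R) ^+ 2 = 2^-1.
    have : cos (pi / 2 : R) = 1 - sin (pi / 4) ^+ 2 *+ 2.
      have -> : pi / 2 = (pi / 4) *+ 2 :> R by rewrite mulr2n; field.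
      by rewrite cos_mulr2n cos2sin2; ring.
    by rewrite cos_pihalf; lra.
  by rewrite e invrK.
set N := (2 ^ m)%N in IHm *.
have N0 : 0 < 2 ^+ m :> R by rewrite exprn_gt0.
have Nr : N%:R = 2 ^+ m :> R by rewrite natrX.
rewrite [4 ^+ _]exprS mulrCA -IHm expnS mul2n -addnn -/N.
rewrite big_split_ord/= [X in _ + X](reindex_inj rev_ord_inj)/=.
rewrite -big_split/= mulr_sumr; apply: eq_bigr => k _.
set x := k.*2.+1%:R * (pi / (4 * 2 ^+ m.+1)) : R.
have xx : k.*2.+1%:R * (pi / (4 * 2 ^+ m)) = x *+ 2 :> R.
  by rewrite /x exprS; field; rewrite gt_eqF.
rewrite xx.
have kN : (k.+1 <= N)%N by [].
have -> : (N + (N - k.+1)).*2.+1%:R * (pi / (4 * 2 ^+ m.+1)) = pi / 2 - x :> R.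
  have -> : ((N + (N - k.+1)).*2.+1 = 4 * N - k.*2.+1)%N by lia.
  rewrite natrB; last by lia.
  by rewrite natrM Nr /x exprS; field; rewrite gt_eqF.
rewrite -[pi / 2 - x]opprB sinN sinBpihalf opprK.
have x0 : 0 < x by rewrite mulr_gt0 ?ltr0n// divr_gt0 ?pi_gt0// mulr_gt0 ?exprn_gt0.
have xpi : x < pi / 2.
  have hk : (k.*2.+1%:R : R) < 4 * 2 ^+ m by rewrite -Nr -natrM ltr_nat; lia.
  rewrite /x mulrA ltr_pdivrMr ?mulr_gt0 ?exprn_gt0//.
  have -> : pi / 2 * (4 * 2 ^+ m.+1) = (4 * 2 ^+ m) * pi :> R by rewrite exprS; field.
  by rewrite ltr_pM2r// pi_gt0.
have s0 : 0 < sin x by rewrite sin_gt0_le_pihalf// x0 ltW.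
have c0 : 0 < cos x by apply: cos_gt0_pihalf; have := pi_gt0 R; lra.
have -> : (sin x) ^- 2 + (cos x) ^- 2 = (cos x * sin x) ^- 2.
  have e := cos2Dsin2 x.
  transitivity ((cos x ^+ 2 + sin x ^+ 2) / (cos x * sin x) ^+ 2).
    by field; rewrite !gt_eqF.
  by rewrite e mul1r.
by rewrite sin_mulr2n; field; rewrite !gt_eqF.
Qed.

(** Since [sin x < x < tan x], replacing [1 / sin x ^ 2] by [1 / x ^ 2] loses at
    most [1] per node, which is negligible against the total [2 * 4 ^ m]. *)
Lemma sum_odd_inv_sqr (R : realType) (m : nat) :
  pi ^+ 2 / 8 * (1 - (2 * 2 ^+ m)^-1) <=
    \sum_(k < 2 ^ m) (k.*2.+1%:R : R) ^- 2 <= pi ^+ 2 / 8.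
Proof.
have pi0 := pi_gt0 R; set h := pi / (4 * 2 ^+ m) : R.
have N0 : 0 < 2 ^+ m :> R by rewrite exprn_gt0.
have h0 : 0 < h by rewrite divr_gt0// mulr_gt0.
have Nr : (2 ^ m)%:R = 2 ^+ m :> R by rewrite natrX.
have kh (k : 'I_(2 ^ m)) : 0 < k.*2.+1%:R * h < pi / 2.
  rewrite mulr_gt0 ?ltr0n//=.
  have hk : (k.*2.+1%:R : R) < 2 * 2 ^+ m.
    by rewrite -Nr -natrM ltr_nat; have := ltn_ord k; lia.
  rewrite /h mulrA ltr_pdivrMr ?mulr_gt0//.
  have -> : pi / 2 * (4 * 2 ^+ m) = (2 * 2 ^+ m) * pi :> R by field.
  by rewrite ltr_pM2r.
have -> : \sum_(k < 2 ^ m) (k.*2.+1%:R : R) ^- 2 =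
    h ^+ 2 * \sum_(k < 2 ^ m) (k.*2.+1%:R * h) ^- 2.
  rewrite mulr_sumr; apply: eq_bigr => k _.
  by field; rewrite !gt_eqF ?ltr0n.
have S := sum_inv_sin2 R m.
have four : 4 ^+ m = (2 ^+ m) ^+ 2 :> R by rewrite exprAC; congr (_ ^+ m); ring.
apply/andP; split.
  have -> : pi ^+ 2 / 8 * (1 - (2 * 2 ^+ m)^-1) =
      h ^+ 2 * (2 * 4 ^+ m - (2 ^ m)%:R) :> R.
    by rewrite Nr four /h; field; rewrite gt_eqF.
  rewrite ler_wpM2l ?sqr_ge0// -S -[X in _ - X%:R]card_ord -sumr_const -sumrB.
  by apply: ler_sum => k _; have /andP[] := inv_sin2_bounds (kh k).
have -> : pi ^+ 2 / 8 = h ^+ 2 * (2 * 4 ^+ m) :> R.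
  by rewrite four /h; field; rewrite gt_eqF.
rewrite ler_wpM2l ?sqr_ge0// -S.
by apply: ler_sum => k _; have /andP[] := inv_sin2_bounds (kh k).
Qed.

Definition inv_sqr_sum (R : realType) (K : nat) : R :=
  \sum_(k < K) (k.+1%:R) ^- 2.

Lemma inv_sqr_sum_double (R : realType) (K : nat) :
  inv_sqr_sum R K.*2 = \sum_(k < K) (k.*2.+1%:R) ^- 2 + inv_sqr_sum R K / 4.
Proof.
rewrite /inv_sqr_sum; elim: K => [|K IHK].
  by rewrite !big_ord0 mul0r addr0.
rewrite doubleS !big_ord_recr/= IHK.
have -> : K.*2.+2%:R = 2 * K.+1%:R :> R by rewrite -natrM mul2n doubleS.
have := ltr0Sn R K; have := ltr0Sn R K.*2.
move: (K.+1%:R : R) (K.*2.+1%:R : R) => a c c0 a0.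
by field; rewrite !gt_eqF.
Qed.

Lemma le_inv_sqr_sum (R : realType) (m n : nat) : (m <= n)%N ->
  inv_sqr_sum R m <= inv_sqr_sum R n.
Proof.
move=> mn; rewrite /inv_sqr_sum -!(big_mkord xpredT (fun k => (k.+1%:R) ^- 2)).
by rewrite (big_cat_nat _ mn)//= lerDl sumr_ge0// => i _; rewrite invr_ge0 exprn_ge0.
Qed.

(** The even terms are a quarter of the whole sum, so that the sum is at most
    [4 / 3] of that of its odd terms. *)
Lemma inv_sqr_sum_le (R : realType) (K : nat) : inv_sqr_sum R K <= pi ^+ 2 / 6.
Proof.
have /andP[_ odd_le] := sum_odd_inv_sqr R K.
have : inv_sqr_sum R K <= inv_sqr_sum R K.*2 by apply: le_inv_sqr_sum; lia.
have : \sum_(k < K) (k.*2.+1%:R : R) ^- 2 <= \sum_(k < 2 ^ K) (k.*2.+1%:R) ^- 2.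
  rewrite -!(big_mkord xpredT (fun k => (k.*2.+1%:R) ^- 2)).
  rewrite (@big_cat_nat _ _ _ K 0 (2 ^ K))//=; last exact/ltnW/ltn_expl.
  by rewrite lerDl sumr_ge0// => i _; rewrite invr_ge0 exprn_ge0.
by rewrite inv_sqr_sum_double; lra.
Qed.

(** Doubling the number of terms divides the error by [4], up to the error
    [pi ^ 2 / 16 / 2 ^ m] made on the odd terms. *)
Lemma inv_sqr_sum_pow2 (R : realType) (m : nat) :
  pi ^+ 2 / 6 - pi ^+ 2 / 4 / 2 ^+ m <= inv_sqr_sum R (2 ^ m).
Proof.
have p2 : 0 < pi ^+ 2 :> R by rewrite exprn_gt0// pi_gt0.
elim: m => [|m IHm].
  rewrite expr0 divr1; apply: (@le_trans _ _ 0); first by lra.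
  by apply: sumr_ge0 => i _; rewrite invr_ge0 exprn_ge0.
rewrite expnS mul2n inv_sqr_sum_double.
have /andP[odd_ge _] := sum_odd_inv_sqr R m.
have N0 : 0 < 2 ^+ m :> R by rewrite exprn_gt0.
move: IHm odd_ge; rewrite [2 ^+ m.+1]exprS !invfM; set q := (2 ^+ m)^-1.
set p := (pi ^+ 2 : R); set S := \sum_(_ < _) _; set z := inv_sqr_sum _ _. nra.
Qed.

Lemma inv_sqr_sum_near (R : realType) (e : R) : 0 < e ->
  exists K, pi ^+ 2 / 6 - e <= inv_sqr_sum R K.
Proof.
move=> e0; have p0 : 0 < pi ^+ 2 / 4 :> R by rewrite divr_gt0 ?exprn_gt0 ?pi_gt0.
pose m := (Num.truncn (pi ^+ 2 / 4 / e)).+1; exists (2 ^ m)%N.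
apply: le_trans (inv_sqr_sum_pow2 R m); rewrite lerD2l lerN2.
have h : m%:R <= 2 ^+ m :> R by rewrite -natrX ler_nat ltnW// ltn_expl.
have : pi ^+ 2 / 4 / e < 2 ^+ m := lt_le_trans (truncnS_gt _) h.
rewrite (ltr_pdivrMr _ _ e0) => k; rewrite ler_pdivrMr ?exprn_gt0//.
by apply: ltW; rewrite [ltRHS]mulrC.
Qed.

(** * The expected size under the Boltzmann law *)

(** The expected contribution of one side. *)
Definition mean_size (R : realType) (t : R) (n : nat) : R :=
  \sum_(i < n) i.+1%:R / (expR (t * i.+1%:R) - 1).

Lemma arith_geom_sum (R : realType) (x : R) (n : nat) :
  (1 - x) ^+ 2 * (\sum_(i < n) i.+1%:R * x ^+ i.+1) =
  x * (1 - n.+1%:R * x ^+ n + n%:R * x ^+ n.+1).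
Proof.
elim: n => [|n IHn]; first by rewrite big_ord0 expr0 mul0r; ring.
rewrite big_ord_recr/= mulrDr IHn !exprS -[n.+2%:R]natr1 -[n.+1%:R]natr1; ring.
Qed.

Lemma inv_expR_subr1 (R : realType) (z : R) (K : nat) : 0 < z ->
  (expR z - 1)^-1 =
  \sum_(k < K) expR (- z) ^+ k.+1 + expR (- z) ^+ K * (expR z - 1)^-1.
Proof.
move=> z0; have z1 := expR_subr1_gt0 z0; have e0 := expR_gt0 z.
elim: K => [|K IHK]; first by rewrite big_ord0 add0r expr0 mul1r.
rewrite big_ord_recr/= {1}IHK -addrA; congr (_ + _).
by rewrite !exprS !expRN; field; rewrite !gt_eqF.
Qed.

Lemma le_expR_subV (R : realType) (w : R) : 0 <= w ->
  w *+ 2 <= expR w - expR (- w).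
Proof.
move=> w0; pose f (c : R) := expR c - expR (- c).
have df (c : R) : is_derive c 1 f (expR c + expR (- c)).
  by apply: trigger_derive; rewrite mulrN1 opprK.
have [|c c0] := @MVT_segment R f (fun c => expR c + expR (- c)) 0 w w0
  (fun c _ => df c).
  by apply: derivable_within_continuous => c _; have [] := df c.
rewrite /f oppr0 subrr !subr0 => ->; rewrite addr0 -[leLHS]mulr_natl ler_wpM2r//.
have := expR_gt0 c; rewrite expRN; move: (expR c) => u u0.
have -> : u + u^-1 = 2 + (u - 1) ^+ 2 / u by field; rewrite gt_eqF.
by rewrite lerDl divr_ge0 ?sqr_ge0// ltW.
Qed.

(** In terms of [w = z / 2] this says [w <= sinh w]. *)
Lemma geom_variance_le (R : realType) (z : R) : 0 < z ->
  expR (- z) / (1 - expR (- z)) ^+ 2 <= z ^- 2.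
Proof.
move=> z0; have Z := onem_expRN_gt0 z0.
set w := z / 2; have w0 : 0 < w by rewrite divr_gt0.
have zw : z = w + w by rewrite /w; field.
have hw := le_expR_subV (ltW w0).
rewrite ler_pdivrMr ?exprn_gt0// mulrC -div1r mulrA mulr1 ler_pdivlMr ?exprn_gt0//.
have e : 1 - expR (- z) = expR (- w) * (expR w - expR (- w)).
  by rewrite mulrBr -!expRD zw opprD addNr expR0.
rewrite e; have -> : expR (- z) = expR (- w) ^+ 2 by rewrite zw opprD expRD.
rewrite exprMn ler_wpM2l ?sqr_ge0// lerXn2r ?nnegrE ?(ltW z0)//; last by lra.
by apply: le_trans hw; rewrite mulrn_wge0// ltW.
Qed.

Lemma le_geom_variance (R : realType) (z : R) : 0 < z ->
  expR (- z) / z ^+ 2 <= expR (- z) / (1 - expR (- z)) ^+ 2.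
Proof.
move=> z0; have Z := onem_expRN_gt0 z0.
rewrite ler_wpM2l ?expR_ge0// lef_pV2 ?posrE ?exprn_gt0//.
rewrite lerXn2r ?nnegrE ?(ltW z0) ?(ltW Z)//.
by have := expR_ge1Dx (- z); lra.
Qed.

Lemma arith_geom_ub (R : realType) (z : R) (n : nat) : 0 < z ->
  \sum_(i < n) i.+1%:R * expR (- z) ^+ i.+1 <= z ^- 2.
Proof.
move=> z0; have Z := onem_expRN_gt0 z0; have E := expR_gt0 (- z).
apply: le_trans (geom_variance_le z0).
rewrite ler_pdivlMr ?exprn_gt0// mulrC arith_geom_sum ler_piMr ?(ltW E)//.
have y0 : 0 <= expR (- z) ^+ n by rewrite exprn_ge0// ltW.
have := mulr_ge0 (mulr_ge0 (ler0n R n) y0) (ltW Z).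
by rewrite exprS -natr1; lra.
Qed.

Lemma arith_geom_lb (R : realType) (z : R) (n : nat) : 0 < z ->
  0 <= 1 - n.+1%:R * expR (- z) ^+ n ->
  expR (- z) / z ^+ 2 * (1 - n.+1%:R * expR (- z) ^+ n) <=
    \sum_(i < n) i.+1%:R * expR (- z) ^+ i.+1.
Proof.
move=> z0 h; have Z := onem_expRN_gt0 z0; have E := expR_gt0 (- z).
apply: le_trans (ler_wpM2r h (le_geom_variance z0)) _.
rewrite mulrAC ler_pdivrMr ?exprn_gt0// [leRHS]mulrC arith_geom_sum.
by rewrite ler_wpM2l ?(ltW E)// lerDl mulr_ge0// exprn_ge0// ltW.
Qed.

Lemma expRM_succ (R : realType) (t : R) (i k : nat) :
  expR (- (t * i.+1%:R)) ^+ k = expR (- (t * k%:R)) ^+ i.+1.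
Proof. by rewrite -!expRM_natr; congr expR; ring. Qed.

Lemma mean_size_split (R : realType) (t : R) (n K : nat) : 0 < t ->
  mean_size t n =
  \sum_(k < K) \sum_(i < n) i.+1%:R * expR (- (t * k.+1%:R)) ^+ i.+1 +
  \sum_(i < n) i.+1%:R *
    (expR (- (t * i.+1%:R)) ^+ K * (expR (t * i.+1%:R) - 1)^-1).
Proof.
move=> t0; rewrite exchange_big/= -big_split/=; apply: eq_bigr => i _.
have ti : 0 < t * i.+1%:R by rewrite mulr_gt0// ltr0n.
rewrite {1}(inv_expR_subr1 K ti) mulrDr mulr_sumr; congr (_ + _).
by apply: eq_bigr => k _; rewrite expRM_succ.
Qed.

Lemma mean_size_ge0 (R : realType) (t : R) (n : nat) : 0 < t ->
  0 <= mean_size t n.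
Proof.
move=> t0; apply: sumr_ge0 => i _; rewrite divr_ge0// ltW// expR_subr1_gt0//.
by rewrite mulr_gt0// ltr0n.
Qed.

(** Expanding [1 / (expR z - 1)] as a geometric series and exchanging the
    sums turns [mean_size] into [\sum_k 1 / (t * k) ^ 2], up to the factor
    [(z / (2 sinh (z / 2))) ^ 2 <= 1] at [z = t * k]. The remainder of the
    geometric series is at most [expR (- t * K)] times [mean_size] itself. *)
Lemma mean_size_ub (R : realType) (t : R) (n : nat) : 0 < t ->
  mean_size t n <= pi ^+ 2 / 6 / t ^+ 2.
Proof.
move=> t0; set B := pi ^+ 2 / 6 / t ^+ 2; have D0 := mean_size_ge0 n t0.
have B0 : 0 <= B by rewrite divr_ge0 ?exprn_ge0 ?(ltW t0)// divr_ge0// exprn_ge0// pi_ge0.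
have main K : mean_size t n <= B + mean_size t n * expR (- (t * K%:R)).
  rewrite {1}(@mean_size_split _ _ _ K t0); apply: lerD.
    apply: (@le_trans _ _ (inv_sqr_sum R K / t ^+ 2)); last first.
      by rewrite ler_wpM2r ?invr_ge0 ?exprn_ge0 ?(ltW t0)// inv_sqr_sum_le.
    rewrite mulr_suml; apply: ler_sum => k _.
    apply: le_trans (@arith_geom_ub _ (t * k.+1%:R) n _) _.
      by rewrite mulr_gt0// ltr0n.
    by rewrite exprMn invfM mulrC.
  rewrite mulr_suml; apply: ler_sum => i _.
  have ti : 0 < t * i.+1%:R by rewrite mulr_gt0// ltr0n.
  rewrite -mulrA ler_wpM2l// [leRHS]mulrC ler_wpM2r//.
    by rewrite invr_ge0 ltW// expR_subr1_gt0.
  rewrite -expRM_natr ler_expR mulNr lerN2 mulrAC ler_peMr//; first by rewrite mulr_ge0// ltW.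
  by rewrite ler1n.
(* [K] is chosen so large that the remainder is less than the excess [D - B]. *)
rewrite leNgt; apply/negP => BD.
set D := mean_size t n in D0 main BD.
have DB : 0 < D - B by rewrite subr_gt0.
pose K := (Num.truncn (D / (D - B) / t)).+1.
have hK : D / (D - B) / t < K%:R := truncnS_gt _.
have := main K; have := expR_ge1Dx (t * K%:R); rewrite expRN.
move: hK; rewrite ltr_pdivrMr// ltr_pdivrMr// => hK.
set u := expR _ => hu hm.
have u0 : 0 < u := expR_gt0 _.
have : D - B <= D / u by lra.
rewrite ler_pdivlMr// => hd.
have : (D - B) * (1 + t * K%:R) <= (D - B) * u by rewrite ler_wpM2l// ltW.
by nra.
Qed.

Lemma mean_size_lb (R : realType) (t : R) (n K : nat) : 0 < t ->
  0 <= 1 - n.+1%:R * expR (- (t * n%:R)) ->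
  expR (- (t * K%:R)) * (1 - n.+1%:R * expR (- (t * n%:R))) *
    (inv_sqr_sum R K / t ^+ 2) <= mean_size t n.
Proof.
move=> t0 h0; rewrite (@mean_size_split _ _ _ K t0) -[leLHS]addr0; apply: lerD.
  rewrite mulr_suml mulr_sumr; apply: ler_sum => k _.
  have tk : 0 < t * k.+1%:R by rewrite mulr_gt0// ltr0n.
  set q := expR (- (t * n%:R)) in h0 *.
  have qk : expR (- (t * k.+1%:R)) ^+ n <= q.
    rewrite -expRM_natr ler_expR mulNr lerN2 mulrAC ler_peMr ?ler1n//.
    by rewrite mulr_ge0// ltW.
  have hk : 1 - n.+1%:R * q <= 1 - n.+1%:R * expR (- (t * k.+1%:R)) ^+ n.
    by rewrite lerD2l lerN2 ler_wpM2l.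
  apply: le_trans (arith_geom_lb tk (le_trans h0 hk)).
  have le_e : expR (- (t * K%:R)) <= expR (- (t * k.+1%:R)).
    by rewrite ler_expR lerN2 ler_wpM2l ?(ltW t0)// ler_nat.
  have -> : (t * k.+1%:R) ^- 2 = k.+1%:R ^- 2 / t ^+ 2 :> R.
    by rewrite exprMn invfM mulrC.
  rewrite [leRHS]mulrAC.
  rewrite ler_wpM2r ?ler_pM ?expR_ge0// mulr_ge0 ?invr_ge0 ?exprn_ge0//.
  exact: ltW.
apply: sumr_ge0 => i _; rewrite mulr_ge0// mulr_ge0 ?exprn_ge0 ?expR_ge0//.
by rewrite invr_ge0 ltW// expR_subr1_gt0// mulr_gt0// ltr0n.
Qed.

(** * Concentration of the size *)

Definition msize (n K : nat) (L : mults n K) : nat :=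
  \sum_(p : bool * 'I_n) L p * p.2.+1.

Lemma prod_boltzmann (R : realType) (t : R) (n K : nat) (L : mults n K) :
  \prod_p boltzmann t p ^+ (L p : nat) = expR (- (t * (msize L)%:R)).
Proof.
rewrite /msize natr_sum mulr_sumr -sumrN expR_sum; apply: eq_bigr => p _.
by rewrite /boltzmann -expRM_natr natrM mulNr; congr expR; ring.
Qed.

Lemma gweight_boltzmann (R : realType) (t : R) (n K : nat) (L : mults n K) :
  gweight (@boltzmann R t n) L =
  (\prod_(p : bool * 'I_n) (1 - boltzmann t p)) * expR (- (t * (msize L)%:R)).
Proof. by rewrite /gweight big_split/= prod_boltzmann. Qed.

(** The tilted law is the Boltzmann law of parameter [t - s]; [s > 0] bounds the
    upper tail of the size and [s < 0] the lower one. *)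
Lemma msize_tilt (R : realType) (t s B : R) (n K : nat) (A : {set mults n K}) :
  0 < t -> s < t ->
  (forall L, L \in A -> s * B <= s * (msize L)%:R) ->
  \sum_(L in A) gweight (@boltzmann R t n) L <=
  expR (s * (2 * mean_size (t - s) n - B)).
Proof.
move=> t0 st hA; have ts0 : 0 < t - s by rewrite subr_gt0.
apply: le_trans (@chernoff R _ K (@boltzmann R t n) (@boltzmann R (t - s) n)
    (expR (- (s * B))) A _ _ (expR_ge0 _) _) _.
- by move=> p; exact: boltzmann01.
- by move=> p; exact: boltzmann01.
- move=> L LA; rewrite !prod_boltzmann -expRD ler_expR.
  by have := hA L LA; lra.
rewrite -expRD ler_expR mulrBr addrC lerD2r.
pose F (b : bool) (i : 'I_n) : R :=
  s * (i.+1%:R / (expR ((t - s) * i.+1%:R) - 1)).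
apply: (@le_trans _ _ (\sum_(p : bool * 'I_n) F p.1 p.2)); last first.
  rewrite -(pair_bigA _ F)/= big_bool/= /F -mulr_sumr -/(mean_size (t - s) n).
  by lra.
apply: ler_sum => -[b i] _; rewrite /F /boltzmann/=.
have j0 : 0 < i.+1%:R :> R by rewrite ltr0n.
move: (i.+1%:R : R) j0 => j j0.
have tsj : 0 < (t - s) * j by rewrite mulr_gt0.
have e0 := expR_subr1_gt0 tsj.
have -> : (expR (- ((t - s) * j)) - expR (- (t * j))) / (1 - expR (- ((t - s) * j)))
    = (1 - expR (- (s * j))) / (expR ((t - s) * j) - 1).
  have -> : expR (- (t * j)) = expR (- ((t - s) * j)) * expR (- (s * j)).
    by rewrite -expRD; congr expR; ring.
  rewrite [expR (- ((t - s) * j))]expRN; field.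
  by rewrite !gt_eqF// expR_gt0.
rewrite mulrA ler_wpM2r//; first by rewrite invr_ge0 ltW.
by have := expR_ge1Dx (- (s * j)); lra.
Qed.

(** * Unimodal sequences and pairs of partitions *)

Lemma geq_trans : transitive geq.
Proof. exact: rev_trans leq_trans. Qed.

Lemma anti_geq : antisymmetric geq.
Proof. by move=> x y; rewrite andbC => /anti_leq. Qed.

Lemma geq_total : total geq.
Proof. by move=> x y; exact: leq_total. Qed.

(** The defining index of unimodality is not unique; the left-most peak always
    works, because the parts between two peaks are peaks. *)
Lemma unimodal_nth (l : seq nat) : unimodal l ->
  [/\ (left_peak l < size l)%N,
      forall i j, (i <= j <= left_peak l)%N -> (nth 0 l i <= nth 0 l j)%N &
      forall i j, (left_peak l <= i <= j)%N -> (nth 0 l j <= nth 0 l i)%N].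
Proof.
case=> _ [k [kl up down]].
have U1 i j : (i <= j <= k)%N -> (nth 0 l i <= nth 0 l j)%N.
  move=> /andP[ij jk].
  have := sorted_leq_nth leq_trans leqnn 0%N up.
  have st : size (take k.+1 l) = k.+1 by rewrite size_takel.
  move=> /(_ i j); rewrite !inE st !ltnS => /(_ (leq_trans ij jk) jk ij).
  by rewrite !nth_take ?ltnS// (leq_trans ij).
have U2 i j : (k <= i <= j)%N -> (nth 0 l j <= nth 0 l i)%N.
  move=> /andP[ki ij]; have [jl|lj] := ltnP j (size l); last by rewrite [leqLHS]nth_default.
  have := sorted_leq_nth geq_trans leqnn 0%N down.
  move=> /(_ (i - k)%N (j - k)%N); rewrite !inE size_drop !nth_drop.
  rewrite !subnKC ?(leq_trans ki)//; apply; lia.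
have maxE : (\max_(a <- l) a)%N = nth 0%N l k.
  apply/eqP; rewrite eqn_leq; apply/andP; split.
    apply/bigmax_leqP_seq => x /(nthP 0%N)[j jl <-] _.
    have [jk|kj] := leqP j k; first by rewrite U1// jk leqnn.
    by rewrite U2// leqnn ltnW.
  by apply: (@leq_bigmax_seq _ _ xpredT id) => //; rewrite mem_nth.
have ml : nth 0%N l k \in l by rewrite mem_nth.
have pk : (left_peak l <= k)%N.
  rewrite /left_peak maxE -ltnS -in_take//.
  by rewrite -(@nth_take k.+1 _ _ k)// mem_nth// size_takel.
have pE : nth 0%N l (left_peak l) = nth 0%N l k by rewrite /left_peak maxE nth_index.
split; first by apply: leq_ltn_trans kl.
- by move=> i j /andP[ij jp]; rewrite U1// ij (leq_trans jp).
- move=> i j /andP[pi ij]; have [ki|ik] := leqP k i; first by rewrite U2// ki.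
  apply: (@leq_trans (nth 0%N l k)); last by rewrite -pE U1// pi ltnW.
  have [kj|jk] := leqP k j; first by rewrite U2// leqnn.
  by rewrite U1// leqnn ltnW.
Qed.

Lemma sorted_take_left_peak (l : seq nat) : unimodal l ->
  sorted leq (take (left_peak l) l).
Proof.
case/unimodal_nth => pl up _; apply/(sortedP 0%N) => i.
rewrite size_takel ?(ltnW pl)// => ip; rewrite !nth_take ?(ltnW ip)//.
by rewrite up// leqnSn ltnW.
Qed.

Lemma sorted_drop_left_peak (l : seq nat) : unimodal l ->
  sorted geq (drop (left_peak l) l).
Proof.
case/unimodal_nth => pl _ down; apply/(sortedP 0%N) => i _.
by rewrite !nth_drop /= down// leq_addr leq_add2l leqnSn.
Qed.

Definition side (l : seq nat) (b : bool) : seq nat :=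
  if b then drop (left_peak l) l else take (left_peak l) l.

Lemma cat_side (l : seq nat) : side l false ++ side l true = l.
Proof. exact: cat_take_drop. Qed.

(** The peaks go to the right side. On sequences of size [n] no multiplicity
    exceeds [n], so that [inord] does not truncate. *)
Definition encode (n : nat) (l : seq nat) : mults n n :=
  [ffun p : bool * 'I_n => inord (count_mem p.2.+1 (side l p.1))].

Lemma unimodal_seqs_mem (n : nat) (l : seq nat) (b : bool) (x : nat) :
  unimodal_seqs n l -> x \in side l b -> (0 < x <= n)%N.
Proof.
move=> [[/allP lpos _] suml] xs.
have xl : x \in l by rewrite -(cat_side l) mem_cat; case: b xs => ->; rewrite ?orbT.
by have := lpos x xl; rewrite -suml (perm_sumn (perm_to_rem xl))/= => ->; rewrite leq_addr.
Qed.

Lemma size_le_sumn (l : seq nat) : all (ltn 0%N) l -> (size l <= sumn l)%N.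
Proof. by elim: l => //= a l IH /andP[a0 /IH]; lia. Qed.

Lemma encodeE (n : nat) (l : seq nat) (b : bool) (i : 'I_n) :
  unimodal_seqs n l -> encode n l (b, i) = count_mem i.+1 (side l b) :> nat.
Proof.
move=> [[lpos _] suml]; rewrite ffunE/= inordK// ltnS.
apply: leq_trans (count_size _ _) _; rewrite -suml.
apply: leq_trans (size_le_sumn lpos).
by rewrite -{2}(cat_side l) size_cat; case: b; rewrite ?leq_addl ?leq_addr.
Qed.

(** Each side is sorted, hence determined by its multiplicities. *)
Lemma encode_inj (n : nat) (l l' : seq nat) :
  unimodal_seqs n l -> unimodal_seqs n l' -> encode n l = encode n l' -> l = l'.
Proof.
move=> ul ul' e.
have pe b : perm_eq (side l b) (side l' b).
  apply/allP => x; rewrite mem_cat => /orP xs; apply/eqP => /=.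
  have /andP[x0 xn] : (0 < x <= n)%N.
    by case: xs; apply: unimodal_seqs_mem.
  have x1 : (x.-1 < n)%N by lia.
  by rewrite -(prednK x0) -!(@encodeE n _ b (Ordinal x1))// e.
rewrite -(cat_side l) -(cat_side l'); congr (_ ++ _).
  apply: (sorted_eq leq_trans anti_leq) (pe false).
    by case: ul => + _; exact: sorted_take_left_peak.
  by case: ul' => + _; exact: sorted_take_left_peak.
apply: (sorted_eq geq_trans anti_geq) (pe true).
  by case: ul => + _; exact: sorted_drop_left_peak.
by case: ul' => + _; exact: sorted_drop_left_peak.
Qed.

Lemma sum_count_mem (n : nat) (f : nat -> nat) (s : seq nat) :
  (forall x, x \in s -> 0 < x <= n)%N ->
  (\sum_(i < n) count_mem i.+1 s * f i.+1 = \sum_(x <- s) f x)%N.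
Proof.
elim: s => [|x s IHs] xn; first by rewrite big_nil big1.
rewrite big_cons -IHs; last by move=> y ys; rewrite xn// inE ys orbT.
have /andP[x0 x1] := xn x (mem_head x s).
under eq_bigr do rewrite /= mulnDl.
rewrite big_split/=; congr (_ + _)%N.
have x1' : (x.-1 < n)%N by lia.
rewrite (bigD1 (Ordinal x1'))//= prednK// eqxx mul1n big1 ?addn0// => i ix.
case: eqP => [xi|_]; last by rewrite mul0n.
by case/eqP: ix; apply: val_inj => /=; rewrite xi.
Qed.

Lemma msize_encode (n : nat) (l : seq nat) : unimodal_seqs n l ->
  msize (encode n l) = n.
Proof.
move=> ul; rewrite /msize.
pose F b (i : 'I_n) := (count_mem i.+1 (side l b) * i.+1)%N.
rewrite (eq_bigr (fun p : bool * 'I_n => F p.1 p.2)); last first.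
  by move=> [b i] _; rewrite encodeE.
rewrite -(pair_bigA _ F)/= big_bool/= /F.
have e b : (\sum_(i < n) count_mem i.+1 (side l b) * i.+1 = sumn (side l b))%N.
  by rewrite (sum_count_mem id) ?sumnE// => x; exact: unimodal_seqs_mem.
by rewrite !e addnC -sumn_cat cat_side; case: ul.
Qed.

Lemma nlarge_encode (n : nat) (l : seq nat) (b : bool) (m : nat) :
  unimodal_seqs n l -> nlarge (encode n l) b m = count (fun x => m < x)%N (side l b).
Proof.
move=> ul; rewrite /nlarge big_mkcond/=.
rewrite -sum1_count [RHS]big_mkcond/=.
rewrite -[RHS](@sum_count_mem n (fun x => if (m < x)%N then 1%N else 0%N)).
  by apply: eq_bigr => i _; rewrite encodeE// ltnS; case: ifP; rewrite ?muln1 ?muln0.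
by move=> x; exact: unimodal_seqs_mem.
Qed.

Lemma card_le_encode (n : nat) (B : set (seq nat)) (A : {set mults n n}) :
  (forall l, B l -> unimodal_seqs n l /\ encode n l \in A) ->
  (#|` fset_set B| <= #|A|)%N.
Proof.
move=> BA.
have finB : finite_set B.
  by apply: sub_finite_set (finite_unimodal_seqs n) => l /BA[].
have inB l : l \in fset_set B -> B l by rewrite in_fset_set// inE.
rewrite cardE -(size_map (encode n)); apply: uniq_leq_size.
  rewrite map_inj_in_uniq ?fset_uniq// => l l' /inB/BA[ul _] /inB/BA[ul' _].
  exact: encode_inj.
by move=> _ /mapP[l /inB/BA[_ lA] ->]; rewrite mem_enum.
Qed.

Definition expand (n K : nat) (L : mults n K) (b : bool) : seq nat :=
  flatten [seq nseq (L (b, i)) (i : nat).+1 | i <- enum 'I_n].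

(** A pair of partitions with small parts is completed to a unimodal sequence
    of size [n] by a single large peak. *)
Definition decode (n K : nat) (L : mults n K) : seq nat :=
  sort leq (expand L false) ++ (n - msize L)%N :: sort geq (expand L true).

Lemma count_expand (n K : nat) (L : mults n K) (b : bool) (i : 'I_n) :
  count_mem i.+1 (expand L b) = L (b, i).
Proof.
rewrite /expand count_flatten -map_comp sumnE big_map big_enum/=.
rewrite (bigD1 i)//= count_nseq/= eqxx mul1n big1 ?addn0// => j ji.
rewrite count_nseq/=; case: eqP => [|_]; last by rewrite mul0n.
by move=> [] /val_inj ji'; rewrite ji' eqxx in ji.
Qed.

Lemma sumn_expand (n K : nat) (L : mults n K) :
  (sumn (expand L false) + sumn (expand L true))%N = msize L.
Proof.
have e b : sumn (expand L b) = (\sum_(i < n) L (b, i) * i.+1)%N.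
  rewrite /expand sumn_flatten -map_comp sumnE big_map big_enum/=.
  by apply: eq_bigr => i _; rewrite sumn_nseq mulnC.
pose F b (i : 'I_n) := (L (b, i) * i.+1)%N.
rewrite /msize (eq_bigr (fun p : bool * 'I_n => F p.1 p.2)); last by case.
by rewrite -(pair_bigA _ F)/= big_bool/= addnC !e.
Qed.

Lemma mem_expand (n K M : nat) (L : mults n K) (b : bool) (x : nat) :
  nlarge L b M = 0%N -> x \in expand L b -> (0 < x <= M)%N.
Proof.
move=> /eqP; rewrite sum_nat_eq0 => /forallP L0.
move=> /flattenP[s /mapP[i _ ->]]; rewrite mem_nseq => /andP[Li /eqP ->] /=.
rewrite ltnNge; apply/negP => Mi.
by have := L0 i; rewrite Mi/= => /eqP Li0; rewrite Li0 in Li.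
Qed.

Lemma left_peak_cat (s1 s2 : seq nat) (v : nat) :
  (forall x, x \in s1 -> x < v)%N -> (forall x, x \in s2 -> x < v)%N ->
  left_peak (s1 ++ v :: s2) = size s1.
Proof.
move=> h1 h2; rewrite /left_peak.
have -> : (\max_(a <- s1 ++ v :: s2) a)%N = v.
  apply/eqP; rewrite eqn_leq; apply/andP; split.
    apply/bigmax_leqP_seq => x; rewrite mem_cat inE => /or3P[/h1/ltnW|/eqP->|/h2/ltnW]//.
  apply: (@leq_bigmax_seq _ _ xpredT id) => //.
  by rewrite mem_cat mem_head orbT.
rewrite index_cat; case: ifP => [/h1|_]; first by rewrite ltnn.
by rewrite /= eqxx addn0.
Qed.

Lemma decode_unimodal (n K M : nat) (L : mults n K) :
  (forall b, nlarge L b M = 0%N) -> (msize L + M < n)%N ->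
  unimodal_seqs n (decode L).
Proof.
move=> L0 Ln; set v := (n - msize L)%N.
have lt_v b x : x \in expand L b -> (0 < x < v)%N.
  by move=> /(mem_expand (L0 b)); rewrite /v; lia.
have v0 : (0 < v)%N by rewrite /v; lia.
split; last first.
  rewrite /decode sumn_cat/= (perm_sumn (permEl (perm_sort _ _))).
  rewrite (perm_sumn (permEl (perm_sort _ _))) addnCA sumn_expand.
  by rewrite subnK//; lia.
split.
  rewrite /decode all_cat/= v0/=; apply/andP; split; apply/allP => x;
    by rewrite mem_sort => /lt_v/andP[].
exists (size (sort leq (expand L false))); split.
- by rewrite size_cat/= addnS ltnS leq_addr.
- rewrite /decode -cat_rcons take_size_cat ?size_rcons//.
  rewrite -rev_sorted rev_rcons/= (path_sortedE geq_trans) rev_sorted.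
  rewrite sort_sorted ?andbT; last exact: leq_total.
  by apply/allP => x; rewrite mem_rev mem_sort => /lt_v/andP[_ /ltnW].
- rewrite /decode drop_size_cat//= (path_sortedE geq_trans).
  rewrite sort_sorted ?andbT; last exact: geq_total.
  by apply/allP => x; rewrite mem_sort => /lt_v/andP[_ /ltnW].
Qed.

Lemma decode_inj (n K M : nat) (L L' : mults n K) :
  (forall b, nlarge L b M = 0%N) -> (msize L + M < n)%N ->
  (forall b, nlarge L' b M = 0%N) -> (msize L' + M < n)%N ->
  decode L = decode L' -> L = L'.
Proof.
move=> L0 Ln L0' Ln' e.
have pk (L1 : mults n K) : (forall b, nlarge L1 b M = 0%N) -> (msize L1 + M < n)%N ->
    left_peak (decode L1) = size (sort leq (expand L1 false)).
  move=> L10 L1n; apply: left_peak_cat => x; rewrite mem_sort;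
    by move=> /(mem_expand (L10 _)); lia.
have : size (sort leq (expand L false)) = size (sort leq (expand L' false)).
  by rewrite -!pk// e.
move=> se; have /eqP := e.
rewrite /decode eqseq_cat// => /andP[/eqP e1 /eqP[_ e2]].
apply/ffunP => -[[] i]; apply: val_inj; rewrite /= -!count_expand.
  by rewrite -(count_sort geq) e2 count_sort.
by rewrite -(count_sort leq) e1 count_sort.
Qed.

Lemma card_decode_le (n K M : nat) (A : {set mults n K}) :
  (forall L, L \in A ->
     (forall b, nlarge L b M = 0%N) /\ (msize L + M < n)%N) ->
  (#|A| <= #|` fset_set (unimodal_seqs n)|)%N.
Proof.
move=> hA; rewrite cardE -(size_map (@decode n K)); apply: uniq_leq_size.
  rewrite map_inj_in_uniq ?enum_uniq// => L L'.
  rewrite !mem_enum => /hA[h1 h2] /hA[h1' h2']; exact: (@decode_inj _ _ M).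
move=> _ /mapP[L + ->]; rewrite mem_enum => /hA[h1 h2].
rewrite in_fset_set ?inE; first exact: (decode_unimodal h1 h2).
exact: finite_unimodal_seqs.
Qed.

(** * From tail counts to the shape *)

Lemma count_le_prefix (a : pred nat) (s : seq nat) (k : nat) :
  (forall i, (k <= i < size s)%N -> ~~ a (nth 0%N s i)) -> (count a s <= k)%N.
Proof.
move=> h; rewrite -(cat_take_drop k s) count_cat.
have -> : count a (drop k s) = 0%N.
  apply/eqP; rewrite -leqn0 leqNgt -has_count; apply/hasPn => x /(nthP 0%N)[i].
  by rewrite size_drop => ik <-; rewrite nth_drop h// leq_addr -ltn_subRL.
by rewrite addn0 (leq_trans (count_size _ _))// size_take; case: ltnP.
Qed.

Lemma prefix_le_count (a : pred nat) (s : seq nat) (k : nat) :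
  (k <= size s)%N -> (forall i, (i < k)%N -> a (nth 0%N s i)) -> (k <= count a s)%N.
Proof.
move=> ks h; rewrite -(cat_take_drop k s) count_cat.
have -> : count a (take k s) = k; last exact: leq_addr.
rewrite -[RHS](size_takel ks); apply/eqP; rewrite -all_count.
apply/allP => x /(nthP 0%N)[i]; rewrite size_takel// => ik <-.
by rewrite nth_take// h.
Qed.

Lemma count_le_suffix (a : pred nat) (s : seq nat) (k : nat) :
  (k <= size s)%N -> (forall i, (i < k)%N -> ~~ a (nth 0%N s i)) ->
  (count a s <= size s - k)%N.
Proof.
move=> ks /(@prefix_le_count (predC a) s k ks); rewrite -(count_predC a s); lia.
Qed.

Lemma suffix_le_count (a : pred nat) (s : seq nat) (k : nat) :
  (forall i, (k <= i < size s)%N -> a (nth 0%N s i)) -> (size s - k <= count a s)%N.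
Proof.
move=> h; have : (count (predC a) s <= k)%N.
  by apply: count_le_prefix => i /h ai; rewrite /= negbK.
by rewrite -(count_predC a s); lia.
Qed.

(** On each side of the peak the columns are monotone: those taller than [Y] lie
    between the peak and the border point, and all the columns between the
    peak and the border point reach [Y]. *)
Lemma shape_count (R : realType) (l : seq nat) (X Y : R) :
  unimodal l -> useq_shape R l (X, Y) -> X != 0 ->
  [/\ 0 <= Y,
      forall m : nat, Y <= m%:R ->
        (count (fun x => m < x)%N (side l (0 < X)))%:R <= `|X| &
      exists2 h : nat, Y <= h%:R &
        `|X| <= (count (fun x => h <= x)%N (side l (0 < X)))%:R].
Proof.
move=> ul; have [pl up down] := unimodal_nth ul.
rewrite /useq_shape/bd/=; set p := left_peak l in pl up down *.
have st : size (take p l) = p by rewrite size_takel// ltnW.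
case=> [[j jl [/andP[X1 X2] ->]]|[j jl [-> /andP[Y1 Y2]]]] X0.
- have [pj|jp] := leqP p j.
    have Xp : 0 < X.
      by rewrite lt_neqAle eq_sym X0/= (le_trans _ X1)// subr_ge0 ler_nat.
    rewrite Xp gtr0_norm//; split=> // [m|].
      rewrite ler_nat => jm; apply: le_trans X1; rewrite -natrB// ler_nat.
      apply: count_le_prefix => i /andP[ij _]; rewrite nth_drop -leqNgt.
      by apply: leq_trans jm; rewrite down//; lia.
    exists (nth 0%N l j) => //; apply: le_trans X2 _.
    rewrite -natrB 1?leqW// ler_nat; apply: prefix_le_count.
      by rewrite size_drop; lia.
    by move=> i ij; rewrite nth_drop down//; lia.
  have Xn : X < 0.
    by rewrite lt_neqAle X0/= (le_trans X2)// subr_le0 ler_nat.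
  rewrite ltNge (ltW Xn)/= ltr0_norm//; split=> // [m|].
    rewrite ler_nat => jm; apply: (@le_trans _ _ (p - j.+1)%:R); last first.
      by rewrite natrB// lerNr opprB.
    rewrite ler_nat -[X in (_ <= X - _)%N]st; apply: count_le_suffix; first by rewrite st.
    move=> i ij; rewrite nth_take -?leqNgt; last lia.
    by apply: leq_trans jm; rewrite up//; lia.
  exists (nth 0%N l j) => //; apply: (@le_trans _ _ (p - j)%:R).
    by rewrite natrB ?(ltnW jp)// lerNl opprB.
  rewrite ler_nat -[X in (X - _ <= _)%N]st; apply: suffix_le_count => i.
  by rewrite st => /andP[ji ip]; rewrite nth_take// up//; lia.
- have Y0 : 0 <= Y by apply: le_trans Y1.
  move: X0; rewrite subr_eq0 eqr_nat => jp.
  have [pj|jp'] := ltnP p j.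
    have Xp : 0 < j%:R - p%:R :> R by rewrite subr_gt0 ltr_nat.
    rewrite Xp gtr0_norm// -natrB 1?ltnW//.
    case: j jl pj jp Xp Y1 Y2 => // j jl pj jp Xp; rewrite [nth 0%N (0%N :: l) _]/= => Y1 Y2.
    have dj : (nth 0%N l j.+1 <= nth 0%N l j)%N by rewrite down//; lia.
    rewrite (minn_idPr dj) in Y1; rewrite (maxn_idPl dj) in Y2.
    split=> // [m Ym|].
      have jm : (nth 0%N l j.+1 <= m)%N by rewrite -(ler_nat R) (le_trans Y1).
      rewrite ler_nat; apply: count_le_prefix => i /andP[ij _].
      by rewrite nth_drop -leqNgt; apply: leq_trans jm; rewrite down//; lia.
    exists (nth 0%N l j) => //; rewrite ler_nat; apply: prefix_le_count.
      by rewrite size_drop leq_sub2r.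
    by move=> i ij; rewrite nth_drop down//; lia.
  have {jp jp'}jp : (j < p)%N by rewrite ltn_neqAle jp.
  have Xn : j%:R - p%:R < 0 :> R by rewrite subr_lt0 ltr_nat.
  rewrite ltNge (ltW Xn)/= ltr0_norm// opprB -natrB 1?ltnW//.
  have uj : (nth 0%N (0%N :: l) j <= nth 0%N l j)%N.
    by case: j jp {jl Y1 Y2 Xn} => // j jp; rewrite /= up//; lia.
  rewrite (minn_idPl uj) in Y1; rewrite (maxn_idPr uj) in Y2.
  split=> // [m Ym|].
    have jm : (nth 0%N (0%N :: l) j <= m)%N by rewrite -(ler_nat R) (le_trans Y1).
    rewrite ler_nat -[X in (_ <= X - _)%N]st; apply: count_le_suffix.
      by rewrite st ltnW.
    move=> i ij; rewrite nth_take -?leqNgt; last lia.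
    apply: leq_trans jm; case: j ij jp {jl Y1 Y2 Xn uj} => // j ij jp.
    by rewrite /= up//; lia.
  exists (nth 0%N l j) => //; rewrite ler_nat -[X in (X - _ <= _)%N]st.
  apply: suffix_le_count => i; rewrite st => /andP[ji ip].
  by rewrite nth_take// up//; lia.
Qed.

Lemma f_s_Gfun (R : realType) (x : R) : let c := pi / Num.sqrt 3 : R in
  0 < x -> f_s R x = Gfun (c * x) / c /\ f_s R (- x) = Gfun (c * x) / c.
Proof.
move=> c x0; have c0 : 0 < c by rewrite divr_gt0 ?pi_gt0 ?sqrtr_gt0.
have cV : Num.sqrt 3 / pi = c^-1 :> R by rewrite /c invf_div.
rewrite /f_s oppr_lt0 x0 ltNge (ltW x0)/= cV -/c mulrN mulNr !mulNr /Gfun.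
by split; ring.
Qed.

(** By [shape_count] the abscissas of the border are tail counts, which [eta]
    controls in units of [1 / t]. Two scales are compared: [a] is the one of
    the Boltzmann law, and [c], slightly smaller, the one of the limit shape.
    Beyond [c * eps / 2] the slope of [Gfun] is at most [2 / (c * eps)], which
    controls the rounding of the height to an integer, a shift by [t]; beyond
    [c * eps] its values are at most [Gfun (c * eps)], which controls the
    passage from [c] to [a]. *)
Lemma tail_counts_shape (R : realType) (eps a eta : R) (n : nat) (l : seq nat) :
  let c := pi / Num.sqrt 3 : R in
  let t := a / Num.sqrt n%:R : R in
  0 < eps -> c <= a -> (0 < n)%N ->
  eta <= c * eps / 4 ->
  t / (c * eps / 2) <= c * eps / 4 -> t <= c * eps / 2 ->
  (a - c) / c * (1 + Gfun (c * eps)) <= c * eps / 4 ->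
  Gfun (t * n%:R) <= eta ->
  unimodal_seqs n l ->
  (forall b (m : nat), (m <= n)%N -> c * eps / 2 <= t * m%:R ->
     `|t * (nlarge (encode n l) b m)%:R - Gfun (t * m%:R)| <= eta) ->
  renormalized_shape R l `<=` curve_nbhd eps (f_s_dom R) (f_s R).
Proof.
move=> c t eps0 ca n0 eta_le t_le t_le2 ac_le Gn_le ul good.
have c0 : 0 < c by rewrite divr_gt0 ?pi_gt0 ?sqrtr_gt0.
have a0 : 0 < a by exact: lt_le_trans ca.
set r := Num.sqrt n%:R : R in t t_le t_le2 Gn_le good *.
have r0 : 0 < r by rewrite sqrtr_gt0 ltr0n.
have t0 : 0 < t by rewrite divr_gt0.
have ce0 : 0 < c * eps by rewrite mulr_gt0.
have eta0 : 0 <= eta.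
  by apply: le_trans Gn_le; apply/ltW/Gfun_gt0; rewrite mulr_gt0 ?ltr0n.
have [uni suml] := ul.
move=> _ [[X Y] sXY <-] /=; rewrite suml -/r.
rewrite /curve_nbhd/=.
have [Yeps|Yeps] := leP `|Y / r| eps; first by right; left.
have [Xeps|Xeps] := leP `|X / r| eps; first by right; right.
left.
have X0 : X != 0 by apply: contraTneq Xeps => ->; rewrite mul0r normr0 -leNgt ltW.
have [Y0 low [h Yh up]] := shape_count uni sXY X0.
have y0 : 0 <= Y / r by rewrite divr_ge0// ltW.
set y := Y / r in Yeps y0 *.
rewrite ger0_norm// in Yeps.
have tY : t * Y = a * y by rewrite /t /y; field; rewrite gt_eqF.
set x := X / r in Xeps *.
have tX : t * `|X| = a * `|x|.
  by rewrite /t /x normrM normfV (gtr0_norm r0); field; rewrite gt_eqF.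
have yp : 0 < y by exact: lt_trans Yeps.
have cy0 : 0 < c * y by rewrite mulr_gt0.
have ay_ge : c * eps <= a * y by rewrite ler_pM// ltW.
have cy_ge : c * eps <= c * y by rewrite ler_wpM2l ?(ltW c0)// ltW.
have upper : a * `|x| <= Gfun (a * y - t) + eta.
  have pos : 0 < a * y - t by lra.
  have h0 : (0 < h)%N.
    by rewrite -(ltr0n R) (lt_le_trans _ Yh)// -(pmulr_rgt0 _ t0) tY mulr_gt0.
  rewrite -tX; apply: le_trans (ler_wpM2l (ltW t0) up) _.
  have e : count (fun x => h <= x)%N (side l (0 < X)) = nlarge (encode n l) (0 < X) h.-1.
    by rewrite nlarge_encode//; apply: eq_count => z; rewrite prednK.
  have th : a * y - t <= t * h.-1%:R.
    by rewrite -tY lerBlDr -[X in _ + X]mulr1 -mulrDr natr1 prednK// ler_wpM2l// ltW.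
  have Gh : Gfun (t * h.-1%:R) <= Gfun (a * y - t) by exact: Gfun_anti.
  rewrite e; have [hn|nh] := leqP h.-1 n.
    have := good (0 < X) _ hn; rewrite ler_norml => hh.
    have /andP[_ ] := hh ltac:(lra); lra.
  have -> : nlarge (encode n l) (0 < X) h.-1 = 0%N.
    by rewrite /nlarge big1// => i /(leq_trans nh); rewrite ltnNge ltnW.
  by rewrite mulr0 addr_ge0// ltW// Gfun_gt0.
have lower : Gfun (a * y + t) - eta <= a * `|x|.
  set m := (Num.truncn Y).+1; have Ym : Y <= m%:R by apply/ltW/truncnS_gt.
  have mY : m%:R <= Y + 1 by rewrite /m -natr1 lerD2r truncn_le.
  rewrite -tX; apply: le_trans (ler_wpM2l (ltW t0) (low m Ym)).
  rewrite -(nlarge_encode _ _ ul).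
  have tm : a * y <= t * m%:R by rewrite -tY ler_wpM2l// ltW.
  have mt : t * m%:R <= a * y + t.
    by rewrite -tY -[X in _ <= _ + X]mulr1 -mulrDr ler_wpM2l// ltW.
  have pos : 0 < t * m%:R by lra.
  have Gm : Gfun (a * y + t) <= Gfun (t * m%:R) by exact: Gfun_anti.
  have [mn|nm] := leqP m n.
    have := good (0 < X) _ mn; rewrite ler_norml => hh.
    have /andP[+ _] := hh ltac:(lra); lra.
  apply: (@le_trans _ _ 0); last by rewrite mulr_ge0// ltW.
  rewrite subr_le0 (le_trans _ Gn_le)//; apply: Gfun_anti.
    by rewrite mulr_gt0 ?ltr0n.
  by apply: le_trans mt; rewrite ler_wpM2l ?(ltW t0)// ler_nat ltnW.
set g := Gfun (c * y) / c.
have g0 : 0 < g by rewrite divr_gt0 ?Gfun_gt0.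
have gc : c * g = Gfun (c * y) by rewrite /g; field; rewrite gt_eqF.
have close : `| g - `|x| | <= eps.
  have d1 : Gfun (a * y - t) - Gfun (a * y) <= c * eps / 4.
    have pos : 0 < a * y - t by lra.
    apply: le_trans (Gfun_diff_le pos _) _; first by rewrite gerBl ltW.
    apply: le_trans t_le; have -> : a * y - (a * y - t) = t by ring.
    rewrite ler_wpM2l ?(ltW t0)// lef_pV2 ?posrE//; first by lra.
    by rewrite divr_gt0.
  have d2 : Gfun (a * y) <= Gfun (c * y).
    by apply: Gfun_anti => //; rewrite ler_wpM2r// ltW.
  have d3 : Gfun (c * y) - Gfun (a * y + t) <= (a - c) / c + c * eps / 4.
    have le_cy : c * y <= a * y + t by rewrite ler_wpDr ?(ltW t0)// ler_wpM2r// ltW.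
    apply: le_trans (Gfun_diff_le cy0 le_cy) _.
    have -> : (a * y + t - c * y) / (c * y) = (a - c) / c + t / (c * y).
      by field; rewrite !gt_eqF.
    rewrite lerD2l; apply: le_trans t_le.
    rewrite ler_wpM2l ?(ltW t0)// lef_pV2 ?posrE ?divr_gt0//.
    by move: ce0 cy_ge; lra.
  have d4 : Gfun (c * y) <= Gfun (c * eps) by apply: Gfun_anti.
  have nx0 : 0 <= `|x| by [].
  have G0 : 0 < Gfun (c * y) by rewrite Gfun_gt0.
  have ac0 : 0 <= (a - c) / c by rewrite divr_ge0 ?(ltW c0)// subr_ge0.
  have acg : (a - c) * g <= (a - c) / c * Gfun (c * eps).
    by rewrite -mulrA ler_wpM2l ?subr_ge0// /g [leLHS]mulrC ler_wpM2l// invr_ge0 ltW.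
  rewrite ler_norml; apply/andP; split.
    have cx : c * `|x| <= a * `|x| by rewrite ler_wpM2r.
    by rewrite -(ler_pM2l c0); lra.
  have ae : c * eps <= a * eps by rewrite ler_wpM2r// ltW.
  rewrite -(ler_pM2l a0); lra.
have [fp fn] := f_s_Gfun g0.
have yE : Gfun (c * g) / c = y by rewrite gc GfunK//; field; rewrite gt_eqF.
have [Xp|Xn] := ltP 0 X.
  exists g; split; [by rewrite /f_s_dom/= gt_eqF | by rewrite fp|].
  have xp : 0 < x by rewrite divr_gt0.
  by rewrite (gtr0_norm xp) in close.
exists (- g); split; [by rewrite /f_s_dom/= oppr_eq0 gt_eqF | by rewrite fn|].
have xn : x <= 0 by rewrite /x pmulr_lle0 ?invr_gt0.
by rewrite (ler0_norm xn) opprK in close; rewrite -normrN opprD !opprK.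
Qed.

(** * Concentration of the tail counts *)

Lemma union_bound (R : realType) (T I : finType) (w : T -> R) (A : {set T})
    (B : I -> pred T) :
  (forall x, 0 <= w x) -> (forall x, x \in A -> exists i, B i x) ->
  \sum_(x in A) w x <= \sum_i \sum_(x | B i x) w x.
Proof.
move=> w0 AB; rewrite (exchange_big_dep xpredT)//=.
rewrite [leRHS](bigID (mem A))/= -[leLHS]addr0; apply: lerD; last first.
  by apply: sumr_ge0 => x _; apply: sumr_ge0.
apply: ler_sum => x /AB[i Bi].
by rewrite (bigD1 i)//= lerDl; apply: sumr_ge0.
Qed.

(** Only heights above [y0 / t] matter: below, the border is near an axis. *)
Definition tail_deviates (R : realType) (t y0 eta : R) (n K : nat)
    (L : mults n K) (p : bool * 'I_n.+1) : bool :=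
  (y0 <= t * p.2%:R) &&
  (eta < `|t * (nlarge L p.1 p.2)%:R - Gfun (t * p.2%:R)|).

(** The exponent is [th / t] times the change of [Gfun] under a shift of its
    argument by at most [t + th], minus [eta]; that change is at most [eta / 4]
    because [Gfun] has slope at most [1 / z] at [z], and the bound on the part
    sizes costs another [eta / 4]. The factor [4 * n.+1]
    counts the two sides, the heights and the two directions. *)
Lemma tail_deviation_prob (R : realType) (t y0 eta th : R) (n K : nat) :
  0 < t -> 0 < y0 -> 0 < th -> th <= y0 / 2 -> th <= eta * y0 / 8 ->
  t <= eta * y0 / 8 -> Gfun (t * n%:R) <= eta / 4 -> (0 < n)%N ->
  \sum_(L in [set L : mults n K | [exists p, tail_deviates t y0 eta L p]]%SET)
    gweight (@boltzmann R t n) L <=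
  (4 * n.+1)%:R * expR (- (th * eta / (2 * t))).
Proof.
move=> t0 y00 th0 th1 th2 t1 Gn n0.
pose w := @gweight R _ K (@boltzmann R t n).
have w0 L : 0 <= w L by apply: gweight_ge0 => p; exact: boltzmann01.
pose B (q : bool * (bool * 'I_n.+1)) (L : mults n K) : bool :=
  (y0 <= t * q.2.2%:R) &&
  if q.1 then Gfun (t * q.2.2%:R) + eta <= t * (nlarge L q.2.1 q.2.2)%:R
  else t * (nlarge L q.2.1 q.2.2)%:R <= Gfun (t * q.2.2%:R) - eta.
apply: le_trans (@union_bound _ _ _ w _ B w0 _) _.
  move=> L; rewrite inE => /existsP[[b m]]; rewrite /tail_deviates/= => /andP[ym].
  rewrite ltr_normr => /orP[h|h].
    by exists (true, (b, m)); rewrite /B/= ym/=; lra.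
  by exists (false, (b, m)); rewrite /B/= ym/=; lra.
set e := expR _; have e0 : 0 < e := expR_gt0 _.
have card4 : (4 * n.+1)%N = #|{: bool * (bool * 'I_n.+1)}|.
  by rewrite !card_prod card_bool card_ord mulnA.
rewrite card4 mulr_natl -sumr_const; apply: ler_sum => -[u [b m]] _.
rewrite /B /=; have [ym|_] := boolP (y0 <= t * (m : nat)%:R); last first.
  by rewrite big_pred0_eq ltW.
have tm0 : 0 < t * (m : nat)%:R by exact: lt_le_trans ym.
have expo : forall z, z <= - (eta / 2) -> expR (th / t * z) <= e.
  move=> z hz; rewrite /e ler_expR.
  have -> : - (th * eta / (2 * t)) = th / t * (- (eta / 2)) by field; rewrite gt_eqF.
  by rewrite ler_wpM2l// divr_ge0// ltW.
have frac (r q : R) : 0 < q -> r <= eta / 4 * q -> r / q <= eta / 4.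
  by move=> q0; rewrite ler_pdivrMr.
have eta0 : 0 < eta by rewrite -(pmulr_lgt0 _ y00); lra.
case: u => /=.
  apply: le_trans (@nlarge_ub R t th _ n K m b t0 th0 _) _; first by lra.
  apply: expo.
  have pos : 0 < t * (m : nat)%:R - th by lra.
  have le_m : t * (m : nat)%:R - th <= t * (m : nat)%:R by rewrite gerBl ltW.
  have := Gfun_diff_le pos le_m.
  have -> : t * (m : nat)%:R - (t * (m : nat)%:R - th) = th by ring.
  have : th / (t * (m : nat)%:R - th) <= eta / 4.
    by apply: frac => //; nra.
  by lra.
apply: le_trans (@nlarge_lb R t th _ n K m b t0 th0 _) _; first by rewrite -ltnS.
apply: expo.
have le_m : t * (m : nat)%:R <= t * (m : nat).+1%:R + th.
  by rewrite ler_wpDr ?(ltW th0)// ler_wpM2l ?(ltW t0)// ler_nat.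
have tn0 : 0 < t * n%:R by rewrite mulr_gt0 ?ltr0n.
have le_n : t * n%:R <= t * n.+1%:R + th.
  by rewrite ler_wpDr ?(ltW th0)// ler_wpM2l ?(ltW t0)// ler_nat.
have := Gfun_diff_le tm0 le_m; have := Gfun_anti tn0 le_n.
have -> : t * (m : nat).+1%:R + th - t * (m : nat)%:R = t + th by rewrite -natr1; ring.
have : (t + th) / (t * (m : nat)%:R) <= eta / 4 by apply: frac => //; nra.
by lra.
Qed.

(** * The total mass of small pairs of the right size *)

Lemma near_sqrtn (R : realType) (C : R) : \forall n \near \oo, C <= Num.sqrt n%:R.
Proof.
exists (Num.truncn (C ^+ 2)).+1 => // n /= hn.
have [C0|C0] := leP C 0; first exact: le_trans (sqrtr_ge0 _).
rewrite -[C]gtr0_norm// -sqrtr_sqr ler_sqrt ?ler0n//.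
by apply/ltW/(lt_le_trans (truncnS_gt _)); rewrite ler_nat.
Qed.

Lemma expR_cube (R : realType) (z : R) : 0 < z -> expR (- z) <= 6 / z ^+ 3.
Proof.
move=> z0; rewrite expRN -[leRHS]invf_div lef_pV2 ?posrE ?expR_gt0 ?divr_gt0 ?exprn_gt0//.
by have := expR_ge1Dxn 2 (ltW z0); rewrite [(3`!)%:R]/=; lra.
Qed.

Lemma expRN_inv (R : realType) (z : R) : 0 <= z -> expR (- z) <= (1 + z)^-1.
Proof.
move=> z0; rewrite expRN lef_pV2 ?posrE ?expR_gt0 ?expR_ge1Dx//.
by rewrite ltr_wpDr.
Qed.

(** Exponentially small in [Num.sqrt n], even after a union bound over [n]
    events. *)
Lemma near_natM_expR (R : realType) (k C e : R) : 0 < k -> 0 < e -> 0 <= C ->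
  \forall n \near \oo, C * n.+1%:R * expR (- (k * Num.sqrt n%:R)) <= e.
Proof.
move=> k0 e0 C0; near=> n.
have r1 : 1 <= Num.sqrt n%:R :> R by near: n; exact: near_sqrtn.
have rC : C * 12 / k ^+ 3 / e <= Num.sqrt n%:R by near: n; exact: near_sqrtn.
have nr : n%:R = Num.sqrt n%:R ^+ 2 :> R by rewrite sqr_sqrtr.
move: (Num.sqrt n%:R) r1 rC nr => r r1 rC nr.
have r0 : 0 < r by lra.
have k3 : 0 < k ^+ 3 by rewrite exprn_gt0.
have kr0 : 0 < k * r by rewrite mulr_gt0.
have nn0 : 0 <= C * n.+1%:R by rewrite mulr_ge0.
apply: le_trans (ler_wpM2l nn0 (expR_cube kr0)) _.
apply: (@le_trans _ _ (C * (2 * r ^+ 2) * (6 / (k * r) ^+ 3))).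
  apply: ler_wpM2r; first by rewrite divr_ge0// exprn_ge0// ltW.
  by rewrite ler_wpM2l// -natr1 nr; nra.
have -> : C * (2 * r ^+ 2) * (6 / (k * r) ^+ 3) = C * 12 / k ^+ 3 / r.
  by field; rewrite !gt_eqF.
by move: rC; rewrite (ler_pdivrMr _ _ e0) (ler_pdivrMr _ _ r0) [e * r]mulrC.
Unshelve. all: by end_near. Qed.

Lemma near_expR (R : realType) (k e : R) : 0 < k -> 0 < e ->
  \forall n \near \oo, expR (- (k * Num.sqrt n%:R)) <= e.
Proof.
move=> k0 e0; near=> n.
have : 1 * n.+1%:R * expR (- (k * Num.sqrt n%:R)) <= e.
  by near: n; exact: near_natM_expR.
by apply: le_trans; rewrite mul1r ler_peMl ?expR_ge0// ler1n.
Unshelve. all: by end_near. Qed.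

Lemma divr_sqrtM (R : realType) (b : R) (n : nat) :
  b / Num.sqrt n%:R * n%:R = b * Num.sqrt n%:R.
Proof.
have [->|n0] := posnP n; first by rewrite sqrtr0 !mulr0.
have r0 : 0 < Num.sqrt n%:R :> R by rewrite sqrtr_gt0 ltr0n.
by rewrite -[X in _ * X]sqr_sqrtr//; field; rewrite gt_eqF.
Qed.

Lemma divr_sqrt_sqr (R : realType) (b z : R) (n : nat) : 0 < b -> (0 < n)%N ->
  z / (b / Num.sqrt n%:R) ^+ 2 = z / b ^+ 2 * n%:R.
Proof.
move=> b0 n0.
have r0 : 0 < Num.sqrt n%:R :> R by rewrite sqrtr_gt0 ltr0n.
by rewrite -[X in _ = _ * X]sqr_sqrtr//; field; rewrite !gt_eqF.
Qed.

Lemma near_mean_size_lb (R : realType) (b d : R) : 0 < b -> 0 < d ->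
  \forall n \near \oo,
    (pi ^+ 2 / 6 / b ^+ 2 - d) * n%:R <= mean_size (b / Num.sqrt n%:R) n.
Proof.
move=> b0 d0; have b20 : 0 < b ^+ 2 by rewrite exprn_gt0.
have p0 : 0 < pi ^+ 2 / 6 :> R by rewrite divr_gt0// exprn_gt0// pi_gt0.
have d1 : 0 < d * b ^+ 2 / 2 by rewrite divr_gt0// mulr_gt0.
have [K hK] := inv_sqr_sum_near d1.
have hK' := inv_sqr_sum_le R K.
(* The two correction factors in [mean_size_lb] are at least [1 - u]. *)
pose u := Num.min (1 / 2) (d * b ^+ 2 / 2 / (pi ^+ 2 / 6)) / 2.
have u0 : 0 < u by rewrite divr_gt0// lt_min divr_gt0//= divr_gt0.
have u1 : u <= 1 / 4.
  have : Num.min (1 / 2) (d * b ^+ 2 / 2 / (pi ^+ 2 / 6)) <= 1 / 2.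
    by rewrite ge_min lexx.
  by rewrite /u; lra.
have u2 : u * 2 * (pi ^+ 2 / 6) <= d * b ^+ 2 / 2.
  by rewrite -ler_pdivlMr// /u divfK// ge_min lexx orbT.
near=> n.
have n0 : (0 < n)%N by near: n; exact: nbhs_infty_gt.
have r0 : 0 < Num.sqrt n%:R :> R by rewrite sqrtr_gt0 ltr0n.
set t := b / Num.sqrt n%:R; have t0 : 0 < t by rewrite divr_gt0.
have h1 : n.+1%:R * expR (- (t * n%:R)) <= u.
  rewrite /t divr_sqrtM -[X in X * _]mul1r.
  by near: n; exact: near_natM_expR.
have h2 : t * K%:R <= u.
  have : b * K%:R / u <= Num.sqrt n%:R by near: n; exact: near_sqrtn.
  rewrite (ler_pdivrMr _ _ u0) => h.
  by rewrite /t mulrAC (ler_pdivrMr _ _ r0) [u * _]mulrC.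
have h1' : 0 <= 1 - n.+1%:R * expR (- (t * n%:R)) by lra.
apply: le_trans (mean_size_lb K t0 h1'); rewrite /t divr_sqrt_sqr// -/t.
have h0 : 0 <= n.+1%:R * expR (- (t * n%:R)) by rewrite mulr_ge0// expR_ge0.
have e1 : 1 - u <= expR (- (t * K%:R)) by have := expR_ge1Dx (- (t * K%:R)); lra.
move: h1 h1' h0 e1; set f := n.+1%:R * _; set g := expR _ => h1 h1' h0 e1.
rewrite !mulrA ler_wpM2r// ler_pdivlMr// mulrBl divfK ?gt_eqF//.
have fg : 1 - u * 2 <= g * (1 - f) by nra.
set z := inv_sqr_sum R K in hK hK' *.
have z0 : 0 <= z by apply: sumr_ge0 => i _; rewrite invr_ge0 exprn_ge0.
have : (1 - u * 2) * z <= g * (1 - f) * z by rewrite ler_wpM2r.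
have : u * 2 * z <= u * 2 * (pi ^+ 2 / 6) by rewrite ler_wpM2l// mulr_ge0// ltW.
lra.
Unshelve. all: by end_near. Qed.

(** Parts of size proportional to [n] are absent: their expected number decays
    exponentially in [Num.sqrt n]. *)
Lemma near_many_parts (R : realType) (a v e : R) (b : bool) :
  0 < a -> 0 < v -> 0 < e ->
  \forall n \near \oo,
    \sum_(L : mults n n | (0 < nlarge L b (Num.truncn (v * n%:R)))%N)
      gweight (@boltzmann R (a / Num.sqrt n%:R) n) L <= e.
Proof.
move=> a0 v0 e0.
(* A tilt [th] of order [1 / e] suffices, as [expR (- e^-1) <= (1 + e^-1)^-1 <= e]. *)
have [th th0 eth] : exists2 th : R, 0 < th & expR (1 - th) <= e.
  exists (1 + e^-1); first by rewrite addr_gt0// invr_gt0.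
  rewrite opprD addNKr; apply: le_trans (expRN_inv _) _; first by rewrite invr_ge0 ltW.
  by rewrite -[leRHS]invrK lef_pV2 ?posrE ?addr_gt0 ?invr_gt0// lerDr.
near=> n.
have n0 : (0 < n)%N by near: n; exact: nbhs_infty_gt.
have r0 : 0 < Num.sqrt n%:R :> R by rewrite sqrtr_gt0 ltr0n.
have nr : n%:R = Num.sqrt n%:R ^+ 2 :> R by rewrite sqr_sqrtr.
set t := a / Num.sqrt n%:R; have t0 : 0 < t by rewrite divr_gt0.
set M := Num.truncn _.
have hM : v * n%:R < M.+1%:R := truncnS_gt _.
have tM : a * v * Num.sqrt n%:R / 2 <= t * M%:R - th.
  have : t * (v * n%:R) <= t * M.+1%:R by rewrite ler_wpM2l// ltW.
  have -> : t * (v * n%:R) = a * v * Num.sqrt n%:R.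
    by rewrite mulrCA divr_sqrtM; ring.
  have t1 : t <= 1.
    by rewrite /t ler_pdivrMr// mul1r; near: n; exact: near_sqrtn.
  have : (1 + th) * 2 / (a * v) <= Num.sqrt n%:R by near: n; exact: near_sqrtn.
  by rewrite ler_pdivrMr ?mulr_gt0// -[M.+1%:R]natr1; lra.
have q0 : 0 < a * v * Num.sqrt n%:R / 2 by rewrite divr_gt0// !mulr_gt0.
have G1 : Gfun (t * M%:R - th) <= t / th.
  apply: le_trans (Gfun_anti q0 tM) _; apply: le_trans (Gfun_le2 q0) _.
  have -> : 2 / (a * v * Num.sqrt n%:R / 2) ^+ 2 =
      8 / (a * v) ^+ 2 / Num.sqrt n%:R ^+ 2 by field; rewrite !gt_eqF.
  have : 8 / (a * v) ^+ 2 / a * th <= Num.sqrt n%:R by near: n; exact: near_sqrtn.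
  move: (Num.sqrt _) @t r0 {hM tM q0 nr M} t0 => r t r0 t0 hr.
  rewrite /t; move: hr; set q := 8 / _ => hr.
  rewrite ler_pdivrMr ?exprn_gt0//.
  have -> : a / r / th * r ^+ 2 = a * r / th by field; rewrite !gt_eqF.
  by move: hr; rewrite ler_pdivlMr// mulrAC ler_pdivrMr// [r * a]mulrC.
have tth : th < t * M%:R by rewrite -subr_gt0 (lt_le_trans q0).
apply: le_trans eth.
rewrite (eq_bigl (fun L : mults n n => t <= t * (nlarge L b M)%:R)); last first.
  by move=> L; rewrite ler_pMr// ler1n.
apply: le_trans (@nlarge_ub R t th t n n M b t0 th0 tth) _.
rewrite ler_expR.
have -> : th / t * (Gfun (t * M%:R - th) - t) = th / t * Gfun (t * M%:R - th) - th.
  by field; rewrite gt_eqF.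
rewrite lerD2r; apply: (@le_trans _ _ (th / t * (t / th))).
  by rewrite ler_wpM2l// divr_ge0// ltW.
by rewrite le_eqVlt; apply/orP; left; apply/eqP; field; rewrite !gt_eqF.
Unshelve. all: by end_near. Qed.

(** The expected size is asymptotically [(1 - w) * n]. The relative tilt
    [s = w / 16] moves it by a factor less than [1 + w / 4], so that the
    exponent at the threshold [(1 - w / 2) * n] is still of order
    [- Num.sqrt n]. *)
Lemma near_size_ub (R : realType) (a w e : R) : 0 < a -> 0 < w <= 1 -> 0 < e ->
  pi ^+ 2 / 3 / a ^+ 2 = 1 - w ->
  \forall n \near \oo,
    \sum_(L : mults n n | (1 - w / 2) * n%:R <= (msize L)%:R)
      gweight (@boltzmann R (a / Num.sqrt n%:R) n) L <= e.
Proof.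
move=> a0 /andP[w0 w1] e0 aw; pose s := w / 16; have s0 : 0 < s by rewrite divr_gt0.
near=> n.
have n0 : (0 < n)%N by near: n; exact: nbhs_infty_gt.
have r0 : 0 < Num.sqrt n%:R :> R by rewrite sqrtr_gt0 ltr0n.
set t := a / Num.sqrt n%:R; have t0 : 0 < t by rewrite divr_gt0.
rewrite (eq_bigl (fun L => L \in
  [set L : mults n n | (1 - w / 2) * n%:R <= (msize L)%:R]%SET)); last first.
  by move=> L; rewrite inE.
apply: le_trans (@msize_tilt R t (s * t) ((1 - w / 2) * n%:R) n n _ t0 _ _) _.
- by rewrite gtr_pMl// /s; lra.
- by move=> L; rewrite inE => hL; rewrite ler_wpM2l// mulr_ge0// ltW.
apply: (@le_trans _ _ (expR (- (s * a * w / 4 * Num.sqrt n%:R)))); last first.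
  by near: n; apply: near_expR => //; rewrite divr_gt0// !mulr_gt0.
rewrite ler_expR.
have -> : - (s * a * w / 4 * Num.sqrt n%:R) = s * t * (- (w / 4) * n%:R).
  transitivity (- (s * w / 4) * (t * n%:R)); last by ring.
  by rewrite /t divr_sqrtM; ring.
have st0 : 0 <= s * t by rewrite mulr_ge0// ltW.
rewrite ler_wpM2l//.
have s1 : 0 < 1 - s by rewrite /s; lra.
have -> : t - s * t = (a * (1 - s)) / Num.sqrt n%:R by rewrite /t; ring.
have b0 : 0 < a * (1 - s) by rewrite mulr_gt0.
have := @mean_size_ub R (a * (1 - s) / Num.sqrt n%:R) n (divr_gt0 b0 r0).
rewrite divr_sqrt_sqr//.
have key : 2 * (pi ^+ 2 / 6 / (a * (1 - s)) ^+ 2) <= 1 - 3 * w / 4.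
  have -> : 2 * (pi ^+ 2 / 6 / (a * (1 - s)) ^+ 2) = (1 - w) / (1 - s) ^+ 2.
    by rewrite -aw; field; rewrite !gt_eqF.
  by rewrite ler_pdivrMr ?exprn_gt0// /s; nra.
have : 2 * (pi ^+ 2 / 6 / (a * (1 - s)) ^+ 2) * n%:R <= (1 - 3 * w / 4) * n%:R.
  by rewrite ler_wpM2r.
lra.
Unshelve. all: by end_near. Qed.

Lemma near_size_lb (R : realType) (a w e : R) : 0 < a -> 0 < w <= 1 -> 0 < e ->
  pi ^+ 2 / 3 / a ^+ 2 = 1 - w ->
  \forall n \near \oo,
    \sum_(L : mults n n | (msize L)%:R <= (1 - 3 * w / 2) * n%:R)
      gweight (@boltzmann R (a / Num.sqrt n%:R) n) L <= e.
Proof.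
move=> a0 /andP[w0 w1] e0 aw; pose s := w / 16; have s0 : 0 < s by rewrite divr_gt0.
have s1 : 0 < 1 + s by rewrite addr_gt0.
have b0 : 0 < a * (1 + s) by rewrite mulr_gt0.
near=> n.
have n0 : (0 < n)%N by near: n; exact: nbhs_infty_gt.
have r0 : 0 < Num.sqrt n%:R :> R by rewrite sqrtr_gt0 ltr0n.
set t := a / Num.sqrt n%:R; have t0 : 0 < t by rewrite divr_gt0.
have st0 : 0 <= s * t by rewrite mulr_ge0// ltW.
rewrite (eq_bigl (fun L => L \in
  [set L : mults n n | (msize L)%:R <= (1 - 3 * w / 2) * n%:R]%SET)); last first.
  by move=> L; rewrite inE.
apply: le_trans (@msize_tilt R t (- (s * t)) ((1 - 3 * w / 2) * n%:R) n n _ t0 _ _) _.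
- by rewrite (le_lt_trans _ t0)// oppr_le0.
- by move=> L; rewrite inE => hL; rewrite !mulNr lerN2 ler_wpM2l.
apply: (@le_trans _ _ (expR (- (s * a * w / 8 * Num.sqrt n%:R)))); last first.
  by near: n; apply: near_expR => //; rewrite divr_gt0// !mulr_gt0.
rewrite ler_expR.
have -> : - (s * a * w / 8 * Num.sqrt n%:R) = - (s * t * ((w / 8) * n%:R)).
  transitivity (- (s * w / 8) * (t * n%:R)); last by ring.
  by rewrite /t divr_sqrtM; ring.
rewrite mulNr lerN2 ler_wpM2l//.
have -> : t - - (s * t) = (a * (1 + s)) / Num.sqrt n%:R by rewrite /t; ring.
have : (pi ^+ 2 / 6 / (a * (1 + s)) ^+ 2 - w / 16) * n%:R <=
    mean_size (a * (1 + s) / Num.sqrt n%:R) n.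
  by near: n; apply: near_mean_size_lb; rewrite ?divr_gt0.
have key : 1 - 5 * w / 4 + w / 8 <= 2 * (pi ^+ 2 / 6 / (a * (1 + s)) ^+ 2).
  have -> : 2 * (pi ^+ 2 / 6 / (a * (1 + s)) ^+ 2) = (1 - w) / (1 + s) ^+ 2.
    by rewrite -aw; field; rewrite !gt_eqF.
  rewrite ler_pdivlMr ?exprn_gt0//.
  have w2 : 0 <= w ^+ 2 by rewrite sqr_ge0.
  have w3 : 0 <= w ^+ 3 by rewrite exprn_ge0// ltW.
  by rewrite /s; lra.
have : (1 - 5 * w / 4 + w / 8) * n%:R <= 2 * (pi ^+ 2 / 6 / (a * (1 + s)) ^+ 2) * n%:R.
  by rewrite ler_wpM2r.
have : 0 <= w * n%:R by rewrite mulr_ge0// ltW.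
lra.
Unshelve. all: by end_near. Qed.

(** The pairs of partitions that a single peak completes to a sequence of size
    [n]: the peak, of size at least [w / 2 * n], exceeds all other parts, and
    it is at most [3 / 2 * w * n], a small fraction of [n]. *)
Definition size_window (R : realType) (w : R) (n : nat) : {set mults n n} :=
  [set L : mults n n |
    [&& nlarge L true (Num.truncn (w / 2 * n%:R)) == 0%N,
        nlarge L false (Num.truncn (w / 2 * n%:R)) == 0%N,
        (1 - 3 * w / 2) * n%:R < (msize L)%:R &
        (msize L)%:R < (1 - w / 2) * n%:R]]%SET.

Lemma near_size_window (R : realType) (a w : R) : 0 < a -> 0 < w <= 1 ->
  pi ^+ 2 / 3 / a ^+ 2 = 1 - w ->
  \forall n \near \oo,
    2^-1 <= \sum_(L in size_window w n)
      gweight (@boltzmann R (a / Num.sqrt n%:R) n) L.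
Proof.
move=> a0 w01 aw; have w0 : 0 < w / 2 by case/andP: w01 => w0 _; rewrite divr_gt0.
have e8 : 0 < 10^-1 :> R by rewrite invr_gt0.
near=> n.
have n0 : (0 < n)%N by near: n; exact: nbhs_infty_gt.
have r0 : 0 < Num.sqrt n%:R :> R by rewrite sqrtr_gt0 ltr0n.
have H1 := near (near_many_parts true a0 w0 e8) n.
have H2 := near (near_many_parts false a0 w0 e8) n.
have H3 := near (near_size_ub a0 w01 e8 aw) n.
have H4 := near (near_size_lb a0 w01 e8 aw) n.
set t := a / Num.sqrt n%:R; have t0 : 0 < t by rewrite divr_gt0.
pose wt := @gweight R _ n (@boltzmann R t n).
have wt0 L : 0 <= wt L by apply: gweight_ge0 => p; exact: boltzmann01.
have total : 1 - 10^-1 <= \sum_L wt L.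
  apply: le_trans (sum_gweight_ge _ _); last by move=> p; exact: boltzmann01.
  rewrite lerD2l lerN2.
  apply: (@le_trans _ _ (\sum_(p : bool * 'I_n) expR (- (t * n%:R)))).
    apply: ler_sum => p _; rewrite /boltzmann -expRM_natr ler_expR mulNr lerN2.
    rewrite -[leRHS]mulrA ler_wpM2l ?(ltW t0)// -natrM ler_nat; lia.
  rewrite sumr_const card_prod card_bool card_ord -[leLHS]mulr_natl /t divr_sqrtM.
  have : 2 * n.+1%:R * expR (- (a * Num.sqrt n%:R)) <= 10^-1.
    by near: n; exact: near_natM_expR.
  apply: le_trans; rewrite ler_wpM2r ?expR_ge0// -natrM ler_nat; lia.
pose M := Num.truncn (w / 2 * n%:R).
pose B (i : 'I_4) (L : mults n n) : bool :=
  nth true [:: (0 < nlarge L true M)%N; (0 < nlarge L false M)%N;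
    (1 - w / 2) * n%:R <= (msize L)%:R;
    (msize L)%:R <= (1 - 3 * w / 2) * n%:R] i.
have bad : \sum_(L in (~: size_window w n)%SET) wt L <=
    10^-1 + (10^-1 + (10^-1 + 10^-1)).
  apply: le_trans (@union_bound _ _ _ wt _ B wt0 _) _.
    move=> L; rewrite !inE -/M !negb_and -!lt0n -!leNgt.
    case/or4P => h; [exists (inord 0)|exists (inord 1)|exists (inord 3)|exists (inord 2)];
      by rewrite /B inordK.
  rewrite !big_ord_recl big_ord0 /B/= addr0.
  apply: lerD; [exact: H1|apply: lerD; [exact: H2|]].
  apply: lerD; [exact: H3|exact: H4].
move: total; rewrite (bigID (mem (size_window w n)))/=.
move: bad; rewrite (eq_bigl (fun L => L \notin size_window w n)); last first.
  by move=> L; rewrite !inE.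
by rewrite /wt; lra.
Unshelve. all: by end_near. Qed.

(** * The limit shape *)

(** In the size window the weight of a pair is at most
    [expR (3 / 2 * w * t * n)] times that of a pair of size [n], and completing
    by a peak is injective. *)
Lemma unimodal_seqs_mass (R : realType) (t w : R) (n : nat) :
  0 < t -> 0 < w <= 1 ->
  \sum_(L in size_window w n) gweight (@boltzmann R t n) L <=
  #|` fset_set (unimodal_seqs n)|%:R *
    ((\prod_(p : bool * 'I_n) (1 - boltzmann t p)) *
       expR (- (t * n%:R)) * expR (3 / 2 * w * (t * n%:R))).
Proof.
move=> t0 /andP[w0 w1].
set Z := \prod_(_ | _) _; set q := Z * _ * _.
have Z0 : 0 <= Z.
  apply: prodr_ge0 => p _; have /andP[_] := @boltzmann01 R t n p t0.
  by rewrite subr_ge0 => /ltW.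
apply: (@le_trans _ _ (\sum_(L in size_window w n) q)).
  apply: ler_sum => L; rewrite inE => /and4P[_ _ lo _].
  rewrite gweight_boltzmann -/Z /q -mulrA ler_wpM2l// -expRD ler_expR.
  have := ler_wpM2l (ltW t0) (ltW lo); lra.
rewrite sumr_const -[leLHS]mulr_natl ler_wpM2r//.
  by rewrite /q !mulr_ge0// expR_ge0.
rewrite ler_nat; apply: (@card_decode_le n n (Num.truncn (w / 2 * n%:R))) => L.
rewrite inE => /and4P[/eqP Lt /eqP Lf _ hi]; split; first by case.
rewrite -(ltr_nat R) natrD.
have : (Num.truncn (w / 2 * n%:R))%:R <= w / 2 * n%:R.
  by rewrite truncn_le mulr_ge0// divr_ge0// ltW.
lra.
Qed.

(** All pairs of size [n] have the same weight, so that counting is measuring. *)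
Lemma bad_unimodal_mass (R : realType) (t : R) (n : nat) (B : set (seq nat))
    (P : pred (mults n n)) :
  0 < t -> (forall l, B l -> unimodal_seqs n l /\ P (encode n l)) ->
  #|` fset_set B|%:R * ((\prod_(p : bool * 'I_n) (1 - boltzmann t p)) *
       expR (- (t * n%:R))) <=
  \sum_(L in [set L | P L]%SET) gweight (@boltzmann R t n) L.
Proof.
move=> t0 BP; set Z := \prod_(_ | _) _.
have Z0 : 0 <= Z.
  apply: prodr_ge0 => p _; have /andP[_] := @boltzmann01 R t n p t0.
  by rewrite subr_ge0 => /ltW.
pose A := [set L : mults n n | P L && (msize L == n)]%SET.
have BA : (#|` fset_set B| <= #|A|)%N.
  apply: card_le_encode => l /BP[ul Pl]; split=> //.
  by rewrite inE Pl msize_encode// eqxx.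
apply: (@le_trans _ _ (\sum_(L in A) gweight (@boltzmann R t n) L)).
  apply: (@le_trans _ _ (#|A|%:R * (Z * expR (- (t * n%:R))))).
    by rewrite ler_wpM2r ?ler_nat// mulr_ge0// expR_ge0.
  rewrite mulr_natl -sumr_const; apply: ler_sum => L; rewrite inE => /andP[_ /eqP e].
  by rewrite gweight_boltzmann -/Z e.
rewrite [leRHS](bigID (fun L => msize L == n))/= (eq_bigl (fun L =>
  (L \in [set L | P L]%SET) && (msize L == n))); last by move=> L; rewrite !inE.
rewrite lerDl sumr_ge0// => L _; apply: gweight_ge0 => p; exact: boltzmann01.
Qed.

Theorem theorem1p2 (R : realType) (eps : R) (heps : 0 < eps) :
  (fun n : nat =>
     (#|` fset_set (unimodal_seqs n)|%:R)^-1 *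
     (#|` fset_set [set l | unimodal_seqs n l /\
            renormalized_shape R l `<=` curve_nbhd eps (f_s_dom R) (f_s R)]|)%:R
     : R) @ \oo --> (1 : R).
Proof.
pose c : R := pi / Num.sqrt 3.
have c0 : 0 < c by rewrite divr_gt0 ?pi_gt0 ?sqrtr_gt0.
have c2 : c ^+ 2 = pi ^+ 2 / 3 by rewrite /c expr_div_n sqr_sqrtr.
have ce0 : 0 < c * eps by rewrite mulr_gt0.
pose eta := c * eps / 4; have eta0 : 0 < eta by rewrite divr_gt0.
pose y0 := c * eps / 2; have y00 : 0 < y0 by rewrite divr_gt0.
pose th := Num.min (y0 / 2) (eta * y0 / 8).
have th0 : 0 < th by rewrite lt_min !divr_gt0// mulr_gt0.
have th1 : th <= y0 / 2 by rewrite ge_min lexx.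
have th2 : th <= eta * y0 / 8 by rewrite ge_min lexx orbT.
have G0 : 0 < 1 + Gfun (c * eps) by rewrite addr_gt0// Gfun_gt0.
have te0 : 0 < th * eta by rewrite mulr_gt0.
(* [a = c + d] exceeds [c], so that pairs of the right size are lighter than
   [n]; [d] is so small that the loss [3 / 2 * w * a] in the exponent, where
   [w * a ^ 2 = a ^ 2 - c ^ 2 <= 3 * c * d], is at most half of the gain
   [th * eta / (2 * a)] of [tail_deviation_prob]. *)
pose d := Num.min c (Num.min (th * eta / (18 * c)) (c * eta / (1 + Gfun (c * eps)))).
have d0 : 0 < d by rewrite !lt_min c0 !divr_gt0// mulr_gt0.
have d1 : d <= c by rewrite ge_min lexx.
have d2 : d * (18 * c) <= th * eta.
  have : d <= th * eta / (18 * c) by rewrite /d !ge_min lexx !orbT.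
  by rewrite ler_pdivlMr// mulr_gt0.
have d3 : d * (1 + Gfun (c * eps)) <= c * eta.
  have : d <= c * eta / (1 + Gfun (c * eps)) by rewrite /d !ge_min lexx !orbT.
  by rewrite ler_pdivlMr.
pose a := c + d; have a0 : 0 < a by rewrite addr_gt0.
have ca : c <= a by rewrite lerDl ltW.
pose w := 1 - c ^+ 2 / a ^+ 2.
have a20 : 0 < a ^+ 2 by rewrite exprn_gt0.
have wa : w * a ^+ 2 = a ^+ 2 - c ^+ 2 by rewrite /w; field; rewrite gt_eqF.
have w01 : 0 < w <= 1.
  rewrite /w subr_gt0 gerBl divr_ge0 ?exprn_ge0 ?(ltW a0) ?(ltW c0)// andbT.
  by rewrite ltr_pdivrMr// mul1r /a; nra.
have aw : pi ^+ 2 / 3 / a ^+ 2 = 1 - w by rewrite -c2 /w; ring.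
have wa_le : 6 * (w * a ^+ 2) <= th * eta by rewrite wa /a; nra.
pose k := th * eta / (4 * a); have k0 : 0 < k by rewrite divr_gt0// mulr_gt0.
apply/cvgrPdist_le => /= e e0; near=> n.
have n0 : (0 < n)%N by near: n; exact: nbhs_infty_gt.
have r0 : 0 < Num.sqrt n%:R :> R by rewrite sqrtr_gt0 ltr0n.
have window : 2^-1 <= \sum_(L in size_window w n)
    gweight (@boltzmann R (a / Num.sqrt n%:R) n) L.
  by near: n; exact: near_size_window.
have small : 8 * n.+1%:R * expR (- (k * Num.sqrt n%:R)) <= e.
  by near: n; exact: near_natM_expR.
have tn : a / Num.sqrt n%:R * n%:R = a * Num.sqrt n%:R := divr_sqrtM a n.
have t_le z : 0 < z -> a / z <= Num.sqrt n%:R -> a / Num.sqrt n%:R <= z.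
  by move=> z0; rewrite !ler_pdivrMr// mulrC.
have t1 : a / Num.sqrt n%:R <= eta * y0 / 8.
  by apply: t_le; [rewrite divr_gt0// mulr_gt0 | near: n; exact: near_sqrtn].
have t2 : a / Num.sqrt n%:R <= c * eps / 2.
  by apply: t_le; [| near: n; exact: near_sqrtn].
have Gn : Gfun (a / Num.sqrt n%:R * n%:R) <= eta / 4.
  rewrite tn; set z := a * _.
  have z0 : 0 < z by rewrite mulr_gt0.
  have z1 : 8 / eta <= z.
    have : 8 / eta / a <= Num.sqrt n%:R by near: n; exact: near_sqrtn.
    by rewrite (ler_pdivrMr _ _ a0) /z [a * _]mulrC.
  have z2 : 1 <= z.
    have : 1 / a <= Num.sqrt n%:R by near: n; exact: near_sqrtn.
    by rewrite (ler_pdivrMr _ _ a0) /z [a * _]mulrC.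
  apply: le_trans (Gfun_le2 z0) _; rewrite ler_pdivrMr ?exprn_gt0//.
  by move: z1; rewrite ler_pdivrMr//; nra.
set t := a / Num.sqrt n%:R in window tn t1 t2 Gn *.
have t0 : 0 < t by rewrite divr_gt0.
set S := unimodal_seqs n; set N := curve_nbhd _ _ _.
pose good := [set l | S l /\ renormalized_shape R l `<=` N].
pose bad := [set l | S l /\ ~ renormalized_shape R l `<=` N].
have finS : finite_set S := finite_unimodal_seqs n.
have cardS : (#|` fset_set S| = #|` fset_set good| + #|` fset_set bad|)%N.
  have finG : finite_set good by apply: sub_finite_set finS => l [].
  have finB : finite_set bad by apply: sub_finite_set finS => l [].
  have -> : S = good `|` bad.
    apply/seteqP; split=> [l Sl|l [[]|[]]//].
    by have [h|h] := pselect (renormalized_shape R l `<=` N); [left|right].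
  rewrite fset_setU// cardfsU; set I := (_ `&` _)%fset.
  suff -> : I = fset0 by rewrite cardfs0 subn0.
  apply/fsetP => l; rewrite /I !inE !in_fset_set//.
  by apply/negP => /andP[]; rewrite !inE => -[_ h] [_].
set q := (\prod_(p : bool * 'I_n) (1 - boltzmann t p)) * expR (- (t * n%:R)).
set U := expR (3 / 2 * w * (t * n%:R)).
pose P := (4 * n.+1)%:R * expR (- (th * eta / (2 * t))).
have bad_le : #|` fset_set bad|%:R * q <= P.
  apply: le_trans (@tail_deviation_prob R t y0 eta th n n t0 y00 th0 th1 th2 t1 Gn n0).
  apply: bad_unimodal_mass => // l [Sl Nl]; split=> //.
  apply: contra_notT Nl => /existsPn ok.
  have Gn' : Gfun (t * n%:R) <= eta by lra.
  apply: (tail_counts_shape heps ca n0 _ _ t2 _ Gn' Sl) => //.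
  - rewrite -/eta -/y0 ler_pdivrMr//; apply: le_trans t1 _.
    by rewrite ler_pdivrMr// ler_peMr ?ler1n// mulr_ge0 ?(ltW eta0) ?(ltW y00).
  - have -> : a - c = d by rewrite /a; ring.
    by rewrite -/eta mulrAC ler_pdivrMr// [eta * c]mulrC.
  - move=> b m mn ym; have m1 : (m < n.+1)%N by [].
    by have := ok (b, Ordinal m1); rewrite /tail_deviates/= ym/= -leNgt.
have S_ge : 2^-1 <= #|` fset_set S|%:R * (q * U).
  exact: le_trans window (unimodal_seqs_mass _ t0 w01).
have U0 : 0 < U := expR_gt0 _.
have PU : 2 * P * U <= e.
  apply: le_trans small; rewrite /P natrM.
  have -> : 2 * (4 * n.+1%:R * expR (- (th * eta / (2 * t)))) * U =
    8 * n.+1%:R * (expR (- (th * eta / (2 * t))) * U) by ring.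
  rewrite ler_wpM2l ?mulr_ge0// /U -expRD ler_expR tn /t /k.
  have -> : - (th * eta / (2 * (a / Num.sqrt n%:R))) + 3 / 2 * w * (a * Num.sqrt n%:R) =
     - (th * eta / (4 * a) * Num.sqrt n%:R) +
     (6 * (w * a ^+ 2) - th * eta) * (Num.sqrt n%:R / (4 * a)).
    by field; rewrite !gt_eqF.
  rewrite gerDl mulr_le0_ge0 ?subr_le0// divr_ge0 ?mulr_ge0 ?(ltW r0) ?(ltW a0)//.
set s : R := (#|` fset_set S|)%:R in S_ge *.
set g : R := (#|` fset_set good|)%:R.
set h : R := (#|` fset_set bad|)%:R in bad_le.
have sgh : s = g + h by rewrite /s /g /h cardS natrD.
have q0 : 0 < q.
  rewrite mulr_gt0 ?expR_gt0//; apply: prodr_gt0 => p _.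
  by have /andP[_] := @boltzmann01 R t n p t0; rewrite subr_gt0.
have s0 : 0 < s.
  by rewrite -(pmulr_lgt0 _ (mulr_gt0 q0 U0)); apply: lt_le_trans S_ge.
have -> : 1 - s^-1 * g = h / s by rewrite sgh in s0 *; field; rewrite gt_eqF.
rewrite ger0_norm ?divr_ge0 ?ler0n ?(ltW s0)//.
(* The normalising constant is a factor of [q], common to both sides. *)
rewrite ler_pdivrMr// -(ler_pM2r q0) -(ler_pM2r U0).
have : h * q * U <= P * U by rewrite ler_wpM2r// ltW.
have : e * 2^-1 <= e * (s * (q * U)) by rewrite ler_wpM2l// ltW.
lra.
Unshelve. all: by end_near. Qed.
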